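(* Let $d\in\mathbb{N}$ and $\alpha\in(0,2)$ with $0<\alpha<d<2\alpha$. The functionals $\|\cdot\|_{\mathcal{R}_{d,\alpha}}$ and $|||\cdot|||_{\mathcal{R}_{d,\alpha}}$ are norms on $\mathcal{R}_{d,\alpha}$. Furthermore, for all $V\in\mathcal{R}_{d,\alpha}$, $$|||V|||_{\mathcal{R}_{d,\alpha}}^2=\gamma_d(2\alpha-d)\,\|\mathcal{I}_{\alpha-\frac d2}V\|_2^2\quad\text{and}\quad \|V\|_{\mathcal{R}_{d,\alpha}}^2=\gamma_d(2\alpha-d)\,\|\mathcal{I}_{\alpha-\frac d2}|V|\|_2^2 .$$
   Context: The fractional Rollnik-class $\mathcal{R}_{d,\alpha}$ (for $0<\alpha<2$, $\alpha<d<2\alpha$) is the set of measurable functions $V$ on $\mathbb{R}^d$ (identified when equal a.e.) with $$\|V\|^2_{\mathcal{R}_{d,\alpha}}=\int_{\mathbb{R}^d}\int_{\mathbb{R}^d}\frac{|V(x)||V(y)|}{|x-y|^{2(d-\alpha)}}\,dx\,dy<\infty .$$ On $\mathcal{R}_{d,\alpha}$ (where $V$ is allowed to be possibly complex-valued) one also defines $$|||V|||^2_{\mathcal{R}_{d,\alpha}}=\int_{\mathbb{R}^d}\int_{\mathbb{R}^d}V(x)\overline{V(y)}|x-y|^{2\alpha-2d}\,dx\,dy .$$ For $\beta\in(0,d)$, $\gamma_d(\beta)=\frac{2^\beta\pi^{d/2}\Gamma(\beta/2)}{\Gamma((d-\beta)/2)}$, and the Riesz potential of order $\beta$ is $\mathcal{I}_\beta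 f(x)=\frac{1}{\gamma_d(\beta)}\int_{\mathbb{R}^d}\frac{f(y)}{|x-y|^{d-\beta}}\,dy$. $\|\cdot\|_2$ is the norm of $L^2(\mathbb{R}^d)$. *)

(* Defs.v *)
From HB Require Import structures.
From mathcomp Require Import all_boot all_order all_algebra.
From mathcomp Require Import complex.
From mathcomp Require Import all_classical all_reals all_analysis.

Set Implicit Arguments.
Unset Strict Implicit.
Unset Printing Implicit Defensive.

Import Order.TTheory GRing.Theory Num.Theory.
Import numFieldNormedType.Exports.

Local Open Scope classical_set_scope.
Local Open Scope ring_scope.
Local Open Scope complex_scope.

Section lebesgue_Rd.
Context {R : realType}.
Local Notation T := (measurableTypeR R).

Definition tuple_of_pair n (p : T * n.-tuple T) : n.+1.-tuple T :=
  [tuple of p.1 :: p.2].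

Definition pair_of_tuple n (t : n.+1.-tuple T) : T * n.-tuple T :=
  (thead t, [tuple of behead t]).

Lemma tuple_of_pairK n : cancel (@tuple_of_pair n) (@pair_of_tuple n).
Proof.
by case=> x t; congr (_, _); exact: val_inj.
Qed.

Lemma pair_of_tupleK n : cancel (@pair_of_tuple n) (@tuple_of_pair n).
Proof. by move=> t; rewrite [RHS]tuple_eta; exact: val_inj. Qed.

Lemma measurable_tuple_of_pair n : measurable_fun setT (@tuple_of_pair n).
Proof. exact: measurable_cons. Qed.

Lemma measurable_pair_of_tuple n : measurable_fun setT (@pair_of_tuple n).
Proof.
apply: measurable_fun_pair; first exact: measurable_tnth.
exact: measurable_behead.
Qed.

Section step.
Variables (n : nat) (mu : {sigma_finite_measure set (n.-tuple T) -> \bar R}).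

Definition lebesgue_step : set (n.+1.-tuple T) -> \bar R :=
  pushforward (lebesgue_measure \x mu)%E (@tuple_of_pair n).

Let m : {measure set (T * n.-tuple T)%type -> \bar R} :=
  (lebesgue_measure \x mu)%E.

HB.instance Definition _ := Measure.copy lebesgue_step
  (measure_function_pushforward__canonical__measure_function_Measure m
    (@measurable_tuple_of_pair n)).

Let sigma_finite_lebesgue_step : sigma_finite setT lebesgue_step.
Proof.
have /sigma_finiteP[F [FT ndF Foo]] :=
  sigma_finiteT (@lebesgue_measure R : {sigma_finite_measure set T -> \bar R}).
have /sigma_finiteP[G [GT ndG Goo]] := sigma_finiteT mu.
exists (fun k => @pair_of_tuple n @^-1` (F k `*` G k)) => [|k].
  apply/esym; rewrite -preimage_bigcup -(preimage_setT (@pair_of_tuple n)).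
  congr (_ @^-1` _); rewrite predeqE => -[x y]; split => // _.
  have [/= i _ Fix] : (\bigcup_k F k) x by rewrite -FT.
  have [/= j _ Gjy] : (\bigcup_k G k) y by rewrite -GT.
  exists (maxn i j) => //; split => /=.
    by move: x Fix; exact/subsetPset/ndF/leq_maxl.
  by move: y Gjy; exact/subsetPset/ndG/leq_maxr.
have [mFk Fkoo] := Foo k; have [mGk Gkoo] := Goo k; split.
  rewrite -[X in measurable X]setTI; apply: measurable_pair_of_tuple => //.
  exact: measurableX.
rewrite /lebesgue_step /pushforward -comp_preimage.
rewrite (_ : _ \o _ = id); last by rewrite funeqE => p; exact: tuple_of_pairK.
by rewrite preimage_id product_measure1E// lte_mul_pinfty// ge0_fin_numE.
Qed.

HB.instance Definition _ := @Measure_isSigmaFinite.Build _ _ _ lebesgue_step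
  sigma_finite_lebesgue_step.

End step.

(* Borel Lebesgue measure on R^n, as an iterated product measure transported   *)
(* to n.-tuple; lebesgue_Rd_box below characterizes it on boxes                *)
Fixpoint lebesgue_Rd n : {sigma_finite_measure set (n.-tuple T) -> \bar R} :=
  if n is k.+1 then lebesgue_step (lebesgue_Rd k)
  else dirac ([tuple] : 0.-tuple T).

Lemma lebesgue_Rd_box n (A : 'I_n -> set T) : (forall i, measurable (A i)) ->
  lebesgue_Rd n [set x | forall i, A i (tnth x i)] =
  (\prod_(i < n) lebesgue_measure (A i))%E.
Proof.
elim: n A => [|n IH] A mA.
  rewrite big_ord0 /= diracE mem_set//; by case.
rewrite big_ord_recl -IH// -product_measure1E//.
- congr (lebesgue_measure \x lebesgue_Rd n)%E; apply/seteqP; split=> [[x t]|[x t]] /=.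
  + move=> H; split; first by have := H ord0; rewrite tnth0.
    by move=> i; have := H (lift ord0 i); rewrite tnthS.
  + by move=> [Ax At] i; case: (unliftP ord0 i) => [j ->|->]; rewrite ?tnthS ?tnth0.
- rewrite (_ : [set _ | _] = \bigcap_(i in setT) ((@tnth n T ^~ i) @^-1` A (lift ord0 i))).
    apply: fin_bigcap_measurable => // i _.
    by rewrite -[X in measurable X]setTI; exact: measurable_tnth.
  by apply/seteqP; split=> x /= H i; [move=> _|]; exact: H.
Qed.

End lebesgue_Rd.

Import ComplexField.Normc.

Section complex_functions.
Context d (T : measurableType d) (R : realType).
Variable mu : {measure set T -> \bar R}.
Implicit Types (f g : T -> R[i]) (S : set (T -> R[i])) (N : (T -> R[i]) -> R).

Definition measurable_funC f : Prop :=
  measurable_fun setT (fun x => complex.Re (f x)) /\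
  measurable_fun setT (fun x => complex.Im (f x)).

(* Rintegral is total: the value is meaningful only when f is integrable *)
Definition integralC f : R[i] :=
  (\int[mu]_x complex.Re (f x)) +i* (\int[mu]_x complex.Im (f x)).

Definition L2norm f : \bar R := 'N[mu]_2%:E[(fun x => (normc (f x))%:E)].

(* S is a set of measurable functions that induces a complex vector space of *)
(* a.e.-equality classes, and N induces a norm on that space                 *)
Record is_norm_on_classes S N : Prop := IsNormOnClasses {
  classes_measurable : forall f, S f -> measurable_funC f;
  classes_ae : forall f g,
    S f -> measurable_funC g -> ae_eq mu setT f g -> S g;
  classes0 : S (fun=> 0);
  classesD : forall f g, S f -> S g -> S (fun x => f x + g x);
  classesZ : forall (c : R[i]) f, S f -> S (fun x => c * f x);
  norm_ae : forall f g, S f -> S g -> ae_eq mu setT f g -> N f = N g;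
  norm_ge0 : forall f, S f -> 0 <= N f;
  norm_eq0 : forall f, S f -> N f = 0 -> ae_eq mu setT f (fun=> 0);
  normZ : forall (c : R[i]) f, S f -> N (fun x => c * f x) = normc c * N f;
  normD : forall f g, S f -> S g -> N (fun x => f x + g x) <= N f + N g }.

End complex_functions.

Section rollnik.
Context {R : realType}.
Variable d : nat.
Local Notation Rd := (d.-tuple (measurableTypeR R)).
Local Notation mu := (lebesgue_Rd d).
Implicit Types (V f : Rd -> R[i]) (alpha beta : R) (x y : Rd).

Definition eucl_dist x y : R :=
  Num.sqrt (\sum_(i < d) ((tnth x i : R) - (tnth y i : R)) ^+ 2).

(* The singular kernels below take the value 0 on the diagonal x = y, because *)
(* a positive or negative power of 0 is 0 for powR and 0^-1 = 0; when 0 < d   *)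
(* this affects only a null set of x for each y                               *)

Definition rollnik_energy alpha V : \bar R :=
  (\int[mu]_y \int[mu]_x
    (normc (V x) * normc (V y) / eucl_dist x y `^ (2 * (d%:R - alpha)))%:E)%E.

Definition rollnik_class alpha : set (Rd -> R[i]) :=
  [set V | measurable_funC V /\ (rollnik_energy alpha V < +oo)%E].

Definition rollnik_norm alpha V : R :=
  Num.sqrt (fine (rollnik_energy alpha V)).

Definition rollnik_form alpha V : R[i] :=
  integralC mu (fun y => integralC mu (fun x =>
    V x * (V y)^* * (eucl_dist x y `^ (2 * alpha - 2 * d%:R))%:C)).

(* The form is Hermitian, so its value is real; Re only fixes the type *)
Definition rollnik_trinorm alpha V : R :=
  Num.sqrt (complex.Re (rollnik_form alpha V)).

Definition Gamma (s : R) : R :=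
  \int[lebesgue_measure]_(t in `]0, +oo[) (t `^ (s - 1) * expR (- t)).

Definition riesz_gamma beta : R :=
  2 `^ beta * pi `^ (d%:R / 2) * Gamma (beta / 2) / Gamma ((d%:R - beta) / 2).

Definition riesz_potential beta f x : R[i] :=
  (riesz_gamma beta)^-1%:C *
  integralC mu (fun y => f y / (eucl_dist x y `^ (d%:R - beta))%:C).

Definition riesz_converges beta f x : Prop :=
  (\int[mu]_y (normc (f y) / eucl_dist x y `^ (d%:R - beta))%:E < +oo)%E.

End rollnik.

(* Main.v *)
Require Import Defs.
From HB Require Import structures.
From mathcomp Require Import all_boot all_order all_algebra.
From mathcomp Require Import complex.
From mathcomp Require Import all_classical all_reals all_analysis.
From mathcomp Require Import measurable_realfun.
From mathcomp Require Import ring lra.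

Import Order.TTheory GRing.Theory Num.Theory.
Import numFieldNormedType.Exports.
Import ComplexField.Normc.

Local Open Scope classical_set_scope.
Local Open Scope ring_scope.
Local Open Scope complex_scope.

Set Implicit Arguments.
Unset Strict Implicit.
Unset Printing Implicit Defensive.

(* Writing |x|^(-2e) as a superposition of Gaussians exp(-s|x|^2) and composing *)
(* Gaussians gives the semigroup law of the Riesz kernels: up to a constant,   *)
(* |x-y|^(2 alpha - 2d) is the integral over z of k(x,z) k(y,z), where k(x,z)  *)
(* is |x-z|^(alpha - 3d/2).  Tonelli (for |V|) and Fubini (for V) then turn    *)
(* both double integrals into squared L^2 norms of potentials, and all norm    *)
(* axioms except definiteness follow from Minkowski.                           *)
(* For definiteness, the same kernel is also a superposition over (s,z) of the *)
(* products exp(-2s|x-z|^2) exp(-2s|y-z|^2) with positive weights, so a real   *)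
(* f of zero energy has vanishing Gaussian transforms for almost all (s,z).    *)
(* Integrating in z over a box and letting s tend to infinity shows that f     *)
(* has zero integral on every box, hence f = 0 a.e.                            *)

(** * Gamma and beta integrals *)

(** Put beta = alpha - d/2. The semigroup law of the Riesz potentials, I_beta I_beta = I_(2 beta),
    says that the Rollnik kernel |x-y|^(-2(d-alpha)) is a constant times the integral over z of
    |x-z|^(beta-d) |y-z|^(beta-d). This is [riesz_composition]; [riesz_gammaM] matches its constant
    with [riesz_gamma]. Here d < 2 alpha means beta > 0, so that the singularities at x and y are
    integrable, and alpha < d means 2 beta < d, so that the integral converges at infinity.

    For any kernel K factored in this way through some k, Tonelli turns the energy of nonnegative
    functions into the integral of a product of potentials ([kernel_energyE]). Finite energy of the
    absolute values then justifies Fubini for signed functions ([kernel_form_potential]). Hence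
    |||V||| is the L^2 norm of a potential that is linear in V, and ||V|| is the same quantity for
    |V|. Both identities follow by comparing constants. Homogeneity follows from linearity, and the
    triangle inequality from [l2_triangle], combined for ||V|| with |V+W| <= |V|+|W| under a
    positive kernel.

    For definiteness, |||V||| = 0 makes the potentials of Re V and Im V vanish, hence also their
    quadratic forms. The form does not depend on how K is factored, so a second factorization,
    through Gaussians ([gauss_kernel_composition]), shows that almost all Gaussian transforms of a
    real f with zero form vanish ([riesz_form_inj]). These transforms average f against bumps that
    concentrate as their width shrinks, and [gauss_transform_inj] recovers f = 0 from them. *)

Lemma ge0_integral_scale (R : realType) (c : R) (f : R -> \bar R) : 0 < c ->
  measurable_fun [set: R] f -> (forall x, 0 <= f x)%E ->
  (\int[lebesgue_measure]_x f x =
   c%:E * \int[lebesgue_measure]_x f (c * x)%R)%E.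
Proof.
move=> c0 mf f0.
pose phi : measurableTypeR R -> measurableTypeR R := fun x => c * x.
have mphi : measurable_fun setT phi by exact: measurable_funM.
have -> : (\int[lebesgue_measure]_x f (c * x)%R =
    \int[pushforward lebesgue_measure phi]_x f x)%E.
  by rewrite ge0_integral_pushforward ?preimage_setT.
pose m : {measure set _ -> \bar R} := mscale (NngNum (ltW c0))
  (measure_function_pushforward__canonical__measure_function_Measure
    (@lebesgue_measure R) mphi).
transitivity (\int[m]_x f x)%E; last first.
  by rewrite ge0_integral_mscale.
(* The pushforward along x -> c x, rescaled by c, gives every interval ]a, b] its length, so it is
   Lebesgue measure. *)
apply: eq_measure_integral => A mA _.
apply: lebesgue_measure_unique => //= _ [[a b]] _ <-.
rewrite /m /mscale /= /pushforward.
have -> : phi @^-1` `]a, b]%classic = `]a / c, b / c]%classic.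
  apply/seteqP; split => x /=; rewrite !in_itv/= ltr_pdivrMr// ler_pdivlMr//;
    by rewrite /phi (mulrC c).
rewrite !lebesgue_measure_itv/= !lte_fin ltr_pM2r ?invr_gt0//.
case: ifP => _; last by rewrite mule0.
by rewrite -!EFinD -EFinM -mulrBl mulrCA divff ?mulr1// gt_eqF.
Qed.

(** The weight of the Mellin transform, cut off to s > 0 so that all integrals below run over the
    whole line and substitutions need no bookkeeping of domains. *)
Definition powR_density (R : realType) (p s : R) : R :=
  s `^ (p - 1) * \1_`]0, +oo[ s.

Lemma powR_density_ge0 (R : realType) (p s : R) : 0 <= powR_density p s.
Proof. by rewrite mulr_ge0 ?powR_ge0. Qed.

Lemma measurable_powR_density (R : realType) (p : R) :
  measurable_fun [set: R] (powR_density p).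
Proof.
apply: measurable_funM; first exact: measurable_powR.
exact: measurable_indic.
Qed.

Lemma powR_densityE (R : realType) (p s : R) :
  0 < s -> powR_density p s = s `^ (p - 1).
Proof.
by move=> s0; rewrite /powR_density indicE mem_set ?mulr1//= in_itv/= s0.
Qed.

Lemma powR_density0 (R : realType) (p s : R) : s <= 0 -> powR_density p s = 0.
Proof.
move=> s0; rewrite /powR_density indicE memNset ?mulr0//= in_itv/=.
by rewrite andbT ltNge s0.
Qed.

Lemma GammaE (R : realType) (p : R) :
  Gamma p = fine (\int[lebesgue_measure]_t (powR_density p t * expR (- t))%:E)%E.
Proof.
rewrite /Gamma /Rintegral integral_mkcond; congr fine.
apply: eq_integral => t _; rewrite patchE /=.
case: ifPn => [|].
  by rewrite inE/= in_itv/= andbT => t0; rewrite powR_densityE.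
rewrite notin_setE/= in_itv/= andbT => /negP; rewrite -leNgt => t0.
by rewrite powR_density0// mul0r.
Qed.

Lemma powR_density_scale (R : realType) (p c s : R) : 0 < c ->
  powR_density p (c * s) = c `^ (p - 1) * powR_density p s.
Proof.
move=> c0; have [s0|s0] := ltP 0 s.
  by rewrite !powR_densityE ?mulr_gt0// powRM// ltW.
by rewrite !powR_density0 ?mulr0// pmulr_rle0.
Qed.

Lemma mellin_expR (R : realType) (p l : R) : 0 < l ->
  (\int[lebesgue_measure]_t (powR_density p t * expR (- (l * t)))%:E =
   (l `^ (- p))%:E *
   \int[lebesgue_measure]_t (powR_density p t * expR (- t))%:E)%E.
Proof.
move=> l0; rewrite (@ge0_integral_scale R l (fun t =>
  (powR_density p t * expR (- t))%:E)) //; last first.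
- by move=> x; rewrite lee_fin mulr_ge0 ?powR_density_ge0 ?expR_ge0.
- apply/measurable_EFinP/measurable_funM; first exact: measurable_powR_density.
  by apply: measurableT_comp => //; exact: oppr_measurable.
rewrite muleA -EFinM.
under [in RHS]eq_integral do rewrite powR_density_scale// -mulrA EFinM.
rewrite ge0_integralZl//; last first.
- by rewrite lee_fin powR_ge0.
- by move=> x _; rewrite lee_fin mulr_ge0 ?powR_density_ge0 ?expR_ge0.
- apply/measurable_EFinP/measurable_funM; first exact: measurable_powR_density.
  by apply: measurableT_comp => //; apply: measurableT_comp;
    [exact: oppr_measurable|exact: measurable_funM].
rewrite muleA -EFinM.
suff -> : l `^ (- p) * l * l `^ (p - 1) = 1 by rewrite mul1e.
rewrite -{2}(powRr1 (ltW l0)) -!powRD ?(gt_eqF l0) ?implybT//.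
by rewrite (_ : - p + 1 + (p - 1) = 0) ?powRr0//; ring.
Qed.

Lemma powR_FTC01 (R : realType) (p e : R) : 0 < p -> 0 < e -> e < 1 ->
  (\int[lebesgue_measure]_(t in `[e, 1%R]) (t `^ (p - 1))%:E =
   ((1 - e `^ p) / p)%:E)%E.
Proof.
move=> p0 e0 e1.
have pos x : e <= x -> 0 < x by exact: lt_le_trans.
have cpow (q x : R) : 0 < x -> {for x, continuous (fun t : R => t `^ q)}.
  move=> x0; apply: differentiable_continuous; apply/derivable1_diffP.
  by apply: derivable_powR; rewrite in_itv/= x0.
rewrite (@continuous_FTC2 _ _ (fun x => x `^ p * p^-1)) //.
- by rewrite powR1 mul1r -EFinB mulrBl mul1r.
- apply: continuous_in_subspaceT => x; rewrite inE/= in_itv/= => /andP[ex _].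
  by apply: cpow; exact: pos.
- split.
  + move=> x; rewrite in_itv/= => /andP[ex _].
    apply: derivableM; last exact: derivable_cst.
    by apply: derivable_powR; rewrite in_itv/= andbT pos// ltW.
  + apply: cvg_at_right_filter; apply: cvgM; last exact: cvg_cst.
    exact: cpow.
  + apply: cvg_at_left_filter; apply: cvgM; last exact: cvg_cst.
    by apply: cpow.
- move=> x; rewrite in_itv/= => /andP[ex _].
  have x0 : 0 < x by rewrite pos// ltW.
  rewrite derive1E deriveM//; last first.
    by apply: derivable_powR; rewrite in_itv/= x0.
  rewrite derive_cst scaler0 add0r -derive1E powR_derive1 ?in_itv/= ?x0//.
  by rewrite /GRing.scale/= mulrA mulVf ?mul1r// gt_eqF.
Qed.

Lemma powR_integral01_lty (R : realType) (p : R) : 0 < p ->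
  (\int[lebesgue_measure]_(t in `]0%R, 1%R]) (t `^ (p - 1))%:E < +oo)%E.
Proof.
move=> p0.
(* [i.+2] keeps the left endpoint strictly below 1, as [powR_FTC01] requires. *)
pose F (i : nat) : set (measurableTypeR R) := `[i.+2%:R^-1, 1%R]%classic.
have F0 i x : F i x -> 0 < x.
  by rewrite /F/= in_itv/= => /andP[+ _]; apply: lt_le_trans; rewrite invr_gt0.
have -> : `]0%R, 1%R]%classic = \bigcup_i F i.
  apply/seteqP; split => x /=.
    rewrite in_itv/= => /andP[x0 x1].
    have [n _ nx] := near_infty_natSinv_lt (PosNum x0).
    exists n => //=; rewrite /F/= in_itv/= x1 andbT ltW// (le_lt_trans _ (nx n _))//=.
    by rewrite lef_pV2 ?posrE// ler_nat.
  by move=> [i _ Fix]; rewrite in_itv/= (F0 _ _ Fix); move: Fix; rewrite /F/= in_itv/= => /andP[].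
have mp : measurable_fun [set: R] (fun t : R => (t `^ (p - 1))%:E).
  by apply/measurable_EFinP; exact: measurable_powR.
have := @ge0_nondecreasing_set_cvg_integral _ _ R F
  (fun t => (t `^ (p - 1))%:E) lebesgue_measure.
move=> /(_ _ _ _ _)/cvg_lim <- //.
- apply: (@le_lt_trans _ _ (p^-1)%:E); last exact: ltry.
  apply: lime_le.
    apply: ereal_nondecreasing_is_cvgn.
    apply: ge0_nondecreasing_set_nondecreasing_integral.
    + apply/nondecreasing_seqP => n; apply/subsetPset; apply: subset_itvr.
      by rewrite bnd_simp lef_pV2 ?posrE// ler_nat.
    + by move=> i; exact: measurable_itv.
    + by move=> i; exact: measurable_funTS.
    + by move=> i x _; rewrite lee_fin powR_ge0.
  apply: nearW => n.
  rewrite /F powR_FTC01//; last by rewrite invf_lt1// ltr1n.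
  by rewrite lee_fin ler_pdivrMr// mulVf ?gt_eqF// lerBlDr lerDl powR_ge0.
- apply/nondecreasing_seqP => n; apply/subsetPset; apply: subset_itvr.
  by rewrite bnd_simp lef_pV2 ?posrE// ler_nat.
- by move=> i; exact: measurable_itv.
- by move=> i; exact: measurable_funTS.
- by move=> i x _; rewrite lee_fin powR_ge0.
Qed.

Lemma powR_le_expR (R : realType) (q : R) :
  exists2 C : R, 0 <= C & forall t, 1 <= t -> t `^ q * expR (- t) <= C * expR (- (2^-1 * t)).
Proof.
pose a : R := `|q| + 1.
have a0 : 0 < a by rewrite ltr_wpDl.
(* This is (2a)^a. It comes from ln u <= u at u = t/(2a), which gives a ln t <= t/2 + a ln(2a). *)
exists (expR (a * ln (2 * a))) => [|t t1]; first exact: expR_ge0.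
have t0 : 0 < t by exact: lt_le_trans t1.
rewrite -expRD (@le_trans _ _ (t `^ a * expR (- t)))//.
  rewrite ler_wpM2r ?expR_ge0// ler_powR// /a.
  by rewrite (le_trans (ler_norm q))// lerDl.
rewrite /powR gt_eqF// -expRD ler_expR.
have ta : 0 < t / (2 * a) by rewrite divr_gt0// mulr_gt0.
have a20 : 0 < 2 * a by rewrite mulr_gt0.
have -> : ln t = ln (t / (2 * a)) + ln (2 * a).
  by rewrite -lnM ?posrE// divfK// gt_eqF.
have H : ln (t / (2 * a)) <= t / (2 * a).
  rewrite -ler_expR lnK ?posrE//.
  by rewrite (le_trans _ (expR_ge1Dx _))// lerDr.
have {}H : a * ln (t / (2 * a)) <= 2^-1 * t.
  rewrite (le_trans (ler_wpM2l (ltW a0) H))//.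
  by rewrite le_eqVlt; apply/orP; left; apply/eqP; field; rewrite gt_eqF.
by rewrite mulrDr; lra.
Qed.

(** On ]0, 1] the integrand is at most t^(p-1); beyond 1 it is at most a multiple of the exponential
    density of rate 1/2, where the 2 in [C * 2] cancels the normalization of that density. *)
Lemma Gamma_integral_lty (R : realType) (p : R) : 0 < p ->
  (\int[lebesgue_measure]_t (powR_density p t * expR (- t))%:E < +oo)%E.
Proof.
move=> p0; have [C C0 HC] := powR_le_expR (p - 1).
have e2 : 0 < 2^-1 :> R by rewrite invr_gt0.
have pdf0 (t : R) : (0 <= (exponential_pdf 2^-1 t)%:E)%E.
  by rewrite lee_fin exponential_pdf_ge0// ltW.
have Cpdf0 (t : R) : (0 <= (C * 2)%:E * (exponential_pdf 2^-1 t)%:E)%E.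
  by rewrite mule_ge0// lee_fin mulr_ge0.
apply: (@le_lt_trans _ _ (\int[lebesgue_measure]_t
   (((fun t : R => (t `^ (p - 1))%:E) \_ `]0%R, 1%R]) t +
    (C * 2)%:E * (exponential_pdf 2^-1 t)%:E))%E).
  apply: ge0_le_integral => //.
  - by move=> x _; rewrite lee_fin mulr_ge0 ?powR_density_ge0 ?expR_ge0.
  - apply/measurable_EFinP/measurable_funM; first exact: measurable_powR_density.
    by apply: measurableT_comp => //; exact: oppr_measurable.
  - apply: emeasurable_funD.
      apply/(measurable_restrictT _ _).1 => //.
      by apply/measurable_EFinP/measurable_funTS; exact: measurable_powR.
    apply: emeasurable_funM => //.
    by apply/measurable_EFinP; exact: measurable_exponential_pdf.
  - move=> t _; have [t0|t0] := leP t 0.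
      rewrite powR_density0// mul0r adde_ge0//.
      by rewrite patchE; case: ifP => // _; rewrite lee_fin powR_ge0.
    rewrite powR_densityE// patchE.
    have [t1|t1] := leP t 1.
      rewrite mem_set/= ?in_itv/= ?t0//.
      rewrite (le_trans _ (leeDl _ (Cpdf0 _)))// lee_fin.
      by rewrite ler_piMr ?powR_ge0// -expR0 ler_expR oppr_le0 ltW.
    rewrite memNset/=; last by rewrite in_itv/= t0 leNgt t1.
    rewrite -[point]/(0%E) add0e exponential_pdfE; last exact: ltW.
    rewrite -EFinM lee_fin (le_trans (HC _ (ltW t1)))//.
    by rewrite mulrA mulfK// mulNr.
rewrite ge0_integralD//.
- rewrite -integral_mkcond lte_add_pinfty ?powR_integral01_lty//.
  rewrite ge0_integralZl//.
  + by rewrite integral_exponential_pdf// mule1 ltry.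
  + by apply/measurable_EFinP; exact: measurable_exponential_pdf.
  + by rewrite lee_fin mulr_ge0.
- by move=> x _; rewrite patchE; case: ifP => // _; rewrite lee_fin powR_ge0.
- apply/(measurable_restrictT _ _).1 => //.
  by apply/measurable_EFinP/measurable_funTS; exact: measurable_powR.
- apply: emeasurable_funM => //.
  by apply/measurable_EFinP; exact: measurable_exponential_pdf.
Qed.

Lemma measurable_Gamma_integrand (R : realType) (p : R) :
  measurable_fun [set: R] (fun t => (powR_density p t * expR (- t))%:E).
Proof.
apply/measurable_EFinP/measurable_funM; first exact: measurable_powR_density.
by apply: measurableT_comp => //; exact: oppr_measurable.
Qed.

Lemma EFin_Gamma (R : realType) (p : R) : 0 < p ->
  (Gamma p)%:E = (\int[lebesgue_measure]_t (powR_density p t * expR (- t))%:E)%E.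
Proof.
move=> p0; rewrite GammaE fineK// ge0_fin_numE ?Gamma_integral_lty//.
by apply: integral_ge0 => x _; rewrite lee_fin mulr_ge0 ?powR_density_ge0 ?expR_ge0.
Qed.

Lemma Gamma_gt0 (R : realType) (p : R) : 0 < p -> 0 < Gamma p.
Proof.
move=> p0; rewrite lt_neqAle; apply/andP; split; last first.
  by apply: Rintegral_ge0 => x _; rewrite mulr_ge0 ?powR_ge0 ?expR_ge0.
apply/eqP => G0; have := EFin_Gamma p0; rewrite -G0 => /esym I0.
have mI := measurable_Gamma_integrand p.
have := (ae_eq_integral_abs lebesgue_measure measurableT mI).1.
rewrite (_ : integral _ _ _ = 0)%E => [/(_ erefl)[N [mN N0 sN]]|]; last first.
  rewrite -[RHS]I0; apply: eq_integral => x _.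
  by rewrite gee0_abs// lee_fin mulr_ge0 ?powR_density_ge0 ?expR_ge0.
have : (lebesgue_measure (`]0%R, 1%R]%classic : set (measurableTypeR R)) <= 0)%E.
  rewrite -N0; apply: le_measure; rewrite ?inE//.
  move=> x/=; rewrite in_itv/= => /andP[x0 _]; apply: sN => /= /(_ I)/eqP.
  rewrite eqe gt_eqF// mulr_gt0 ?expR_gt0// powR_densityE//.
  by rewrite powR_gt0.
by rewrite lebesgue_measure_itv/= lte01 oppr0 adde0 leNgt lte01.
Qed.

Lemma integral_powR_density_expR (R : realType) (p l : R) : 0 < p -> 0 < l ->
  (\int[lebesgue_measure]_t (powR_density p t * expR (- (l * t)))%:E =
   (l `^ (- p) * Gamma p)%:E)%E.
Proof. by move=> p0 l0; rewrite mellin_expR// EFinM -EFin_Gamma. Qed.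

(** * Polar substitution in the quarter plane and Euler's beta integral *)

Section fubini_polar.
Variable R : realType.
Local Notation T := (measurableTypeR R).

(** Substitute t = s m at fixed s > 0 and exchange the integrals: s acts as a radius and m as a
    slope. Integrands built from homogeneous functions of (s, t) then become Gamma integrals in
    s. *)
Lemma integral_polar (F : T -> T -> R) :
  measurable_fun setT (fun x : T * T => F x.1 x.2) ->
  (forall s t, 0 <= F s t) -> (forall s t, s <= 0 -> F s t = 0) ->
  (\int[lebesgue_measure]_s \int[lebesgue_measure]_t (F s t)%:E =
   \int[lebesgue_measure]_m \int[lebesgue_measure]_s (s * F s (s * m)%R)%:E)%E.
Proof.
move=> mF F0 Fs.
transitivity (\int[lebesgue_measure]_s \int[lebesgue_measure]_m
   (s * F s (s * m)%R)%:E)%E; last first.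
  apply: (fubini_tonelli (fun x : T * T => (x.1 * F x.1 (x.1 * x.2))%:E)).
    apply/measurable_EFinP/measurable_funM => //.
    apply: (measurableT_comp (f := fun x : T * T => F x.1 x.2)
      (g := fun x : T * T => (x.1, x.1 * x.2))) => //.
    apply: measurable_fun_pair => //.
    exact: measurable_funM.
  move=> [s m]/=; rewrite lee_fin; have [s0|s0] := leP s 0.
    by rewrite Fs// mulr0.
  by rewrite mulr_ge0// ltW.
apply: eq_integral => s _; have [s0|s0] := leP s 0.
  by under eq_integral do rewrite Fs//; under [RHS]eq_integral do rewrite Fs// mulr0.
have mFs : measurable_fun setT (F s).
  apply: (measurableT_comp (f := fun x : T * T => F x.1 x.2)
      (g := fun x : T => (s, x))) => //.
  exact: measurable_fun_pair.
rewrite (@ge0_integral_scale _ s (fun t => (F s t)%:E))//; first last.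
- by move=> x; rewrite lee_fin.
- exact/measurable_EFinP.
under [RHS]eq_integral do rewrite EFinM.
rewrite ge0_integralZl//.
- apply/measurable_EFinP; apply: measurableT_comp => //; exact: measurable_funM.
- by move=> x _; rewrite lee_fin.
- by rewrite lee_fin ltW.
Qed.

(** Euler's beta function at (p, p), in its form on the half-line. *)
Definition beta_integral (p : R) : \bar R :=
  (\int[lebesgue_measure]_m (powR_density p m * (1 + m) `^ (- (2 * p)))%:E)%E.

Lemma powR_densityM (p q s : R) :
  powR_density p s * s `^ q = powR_density (p + q) s.
Proof.
have [s0|s0] := leP s 0; first by rewrite !powR_density0// mul0r.
rewrite !powR_densityE// -powRD ?(gt_eqF s0) ?implybT//.
by congr (_ `^ _); ring.
Qed.

Lemma powR_density_polar (p s m : R) :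
  s * (powR_density p s * powR_density p (s * m)) =
  powR_density p m * powR_density (2 * p) s.
Proof.
have [s0|s0] := leP s 0; first by rewrite !(powR_density0 _ s0) !(mulr0, mul0r).
rewrite powR_density_scale// !(powR_densityE _ s0).
rewrite (_ : 2 * p - 1 = 1 + (p - 1) + (p - 1)); last by ring.
rewrite !powRD ?(gt_eqF s0) ?implybT// powRr1 ?(ltW s0)//.
by ring.
Qed.

(** Gamma(p)^2 is the double integral of s^(p-1) t^(p-1) exp(-s-t); along the slope m its radial
    integral is Gamma(2p) (1+m)^(-2p). *)
Lemma Gamma_beta_integral (p : R) : 0 < p ->
  ((Gamma p ^+ 2)%:E = (Gamma (2 * p))%:E * beta_integral p)%E.
Proof.
move=> p0; have p20 : 0 < 2 * p by rewrite mulr_gt0.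
have G0 := Gamma_gt0 p0; have G20 := Gamma_gt0 p20.
have mg (q l : R) : measurable_fun [set: T]
    (fun t => (powR_density q t * expR (- (l * t)))%:E).
  apply/measurable_EFinP/measurable_funM; first exact: measurable_powR_density.
  by do 2 apply: measurableT_comp => //; exact: measurable_funM.
have g0 (q l t : R) : (0 <= (powR_density q t * expR (- (l * t)))%:E)%E.
  by rewrite lee_fin mulr_ge0 ?powR_density_ge0 ?expR_ge0.
have : (\int[lebesgue_measure]_t (powR_density p t * expR (- (1 * t)))%:E =
    (Gamma p)%:E)%E.
  by rewrite (integral_powR_density_expR p0 ltr01) powR1 mul1r.
move: (Gamma p) G0 => g gt0 I1.
have -> : ((g ^+ 2)%:E = \int[lebesgue_measure]_s \int[lebesgue_measure]_t
   (powR_density p s * powR_density p t * expR (- (s + t)))%:E)%E.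
  transitivity (\int[lebesgue_measure]_s
      (g%:E * (powR_density p s * expR (- (1 * s)))%:E))%E.
    rewrite ge0_integralZl//; last by rewrite lee_fin ltW.
    by rewrite I1 -EFinM expr2.
  apply: eq_integral => s _.
  transitivity (\int[lebesgue_measure]_t
      ((powR_density p s * expR (- (1 * s)))%:E *
       (powR_density p t * expR (- (1 * t)))%:E))%E.
    by rewrite ge0_integralZl// I1 muleC.
  by apply: eq_integral => t _; rewrite -EFinM !mul1r opprD expRD; congr EFin; ring.
rewrite (@integral_polar (fun s t =>
  powR_density p s * powR_density p t * expR (- (s + t)))); last 3 first.
- apply: measurable_funM; first apply: measurable_funM.
  + by apply: measurableT_comp; first exact: measurable_powR_density.
  + by apply: measurableT_comp; first exact: measurable_powR_density.
  + apply: measurableT_comp => //; apply: measurableT_comp => //.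
    exact: measurable_funD.
- by move=> s t; rewrite mulr_ge0 ?expR_ge0// mulr_ge0 ?powR_density_ge0.
- by move=> s t s0; rewrite powR_density0// !mul0r.
rewrite /beta_integral -ge0_integralZl//; last 3 first.
- apply/measurable_EFinP/measurable_funM; first exact: measurable_powR_density.
  by apply: (measurableT_comp (measurable_powR _)); exact: measurable_funD.
- by move=> m _; rewrite lee_fin mulr_ge0 ?powR_density_ge0 ?powR_ge0.
- by rewrite lee_fin ltW.
apply: eq_integral => m _.
have [m0|m0] := leP m 0.
  rewrite powR_density0// mul0r mule0.
  apply: integral0_eq => s _; rewrite mulrA powR_density_polar.
  by rewrite powR_density0// !mul0r.
have m1 : 0 < 1 + m by rewrite addr_gt0.
transitivity (\int[lebesgue_measure]_s ((powR_density p m)%:E *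
  (powR_density (2 * p) s * expR (- ((1 + m) * s)))%:E))%E.
  apply: eq_integral => s _; rewrite -EFinM mulrA powR_density_polar.
  by rewrite (mulrDl 1 m s) mul1r (mulrC m s) !mulrA.
rewrite ge0_integralZl//; last by rewrite lee_fin powR_density_ge0.
rewrite integral_powR_density_expR// -!EFinM; congr EFin; ring.
Qed.

Lemma beta_integral_fin_num (p : R) : 0 < p -> beta_integral p \is a fin_num.
Proof.
move=> p0; have := Gamma_beta_integral p0.
have G20 : 0 < Gamma (2 * p) by rewrite Gamma_gt0// mulr_gt0.
case: (beta_integral p) => // [|]; first by rewrite gt0_muley.
by rewrite gt0_muleNy.
Qed.

Lemma beta_integralE (p : R) : 0 < p ->
  beta_integral p = (Gamma p ^+ 2 / Gamma (2 * p))%:E.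
Proof.
move=> p0; have := Gamma_beta_integral p0.
have G20 : 0 < Gamma (2 * p) by rewrite Gamma_gt0// mulr_gt0.
rewrite -(fineK (beta_integral_fin_num p0)) -EFinM => -[->].
by rewrite mulrC mulKf// gt_eqF.
Qed.

(* This is the integral that the Gaussian composition rule produces from *)
(* k * k, where k is the kernel |x|^{2p-2h}, h = d/2 and l = |x - y|^2.   *)
Lemma integral_harmonic_expR (h p l : R) : 0 < p -> 0 < h - 2 * p -> 0 < l ->
  (\int[lebesgue_measure]_s \int[lebesgue_measure]_t
     (powR_density (h - p) s * powR_density (h - p) t *
      ((s + t) `^ (- h) * expR (- (s * t * (s + t) `^ (-1) * l))))%:E =
   (l `^ (- (h - 2 * p)) * Gamma (h - 2 * p) * (Gamma p ^+ 2 / Gamma (2 * p)))%:E)%E.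
Proof.
move=> p0 hp0 l0.
rewrite (@integral_polar (fun s t =>
  powR_density (h - p) s * powR_density (h - p) t *
      ((s + t) `^ (- h) * expR (- (s * t * (s + t) `^ (-1) * l))))); last 3 first.
- have mD : measurable_fun setT (fun x : T * T => x.1 + x.2 : T).
    exact: measurable_funD.
  apply: measurable_funM; first apply: measurable_funM.
  + by apply: measurableT_comp; first exact: measurable_powR_density.
  + by apply: measurableT_comp; first exact: measurable_powR_density.
  + apply: measurable_funM; first exact: (measurableT_comp (measurable_powR _)).
    do 2 apply: measurableT_comp => //; apply: measurable_funM => //.
    apply: measurable_funM; first exact: measurable_funM.
    exact: (measurableT_comp (measurable_powR _)).
- by move=> s t; rewrite mulr_ge0 ?mulr_ge0 ?expR_ge0 ?powR_ge0 ?powR_density_ge0.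
- by move=> s t s0; rewrite powR_density0// !mul0r.
rewrite EFinM -beta_integralE// /beta_integral -ge0_integralZl//; last 3 first.
- apply/measurable_EFinP/measurable_funM; first exact: measurable_powR_density.
  by apply: (measurableT_comp (measurable_powR _)); exact: measurable_funD.
- by move=> m _; rewrite lee_fin mulr_ge0 ?powR_density_ge0 ?powR_ge0.
- by rewrite lee_fin mulr_ge0 ?powR_ge0// ltW// Gamma_gt0.
apply: eq_integral => m _.
have [m0|m0] := leP m 0.
  rewrite powR_density0// mul0r mule0.
  apply: integral0_eq => s _; rewrite mulrA powR_density_polar.
  by rewrite powR_density0// !mul0r.
have m1 : 0 < 1 + m by rewrite addr_gt0.
have m1V : (1 + m) `^ (-1) = (1 + m)^-1 by rewrite powR_inv1// ltW.
have lm0 : 0 < m / (1 + m) * l by rewrite !mulr_gt0// invr_gt0.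
(* With t = s m one has st/(s+t) = s m/(1+m) and (s+t)^(-h) = s^(-h) (1+m)^(-h), which leaves a
   Gamma integral of exponent h - 2p in s. Its value multiplies the remaining factors in m to
   m^(p-1) (1+m)^(-2p), the beta integrand. *)
transitivity (\int[lebesgue_measure]_s ((powR_density (h - p) m * (1 + m) `^ (- h))%:E *
  (powR_density (h - 2 * p) s * expR (- (m / (1 + m) * l * s)))%:E))%E.
  apply: eq_integral => s _; rewrite -EFinM mulrA powR_density_polar.
  have [s0|s0] := leP s 0.
    by rewrite !(powR_density0 _ s0) !(mul0r, mulr0).
  have -> : s + s * m = s * (1 + m) by ring.
  rewrite !powRM ?(ltW s0) ?(ltW m1)// m1V powR_inv1 ?(ltW s0)//.
  rewrite (_ : h - 2 * p = 2 * (h - p) + (- h)); last by ring.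
  rewrite -(powR_densityM (2 * (h - p)) (- h) s).
  have -> : s * (s * m) * (s^-1 / (1 + m)) * l = m / (1 + m) * l * s.
    by field; rewrite !gt_eqF.
  by congr EFin; ring.
rewrite ge0_integralZl//; last 3 first.
- apply/measurable_EFinP/measurable_funM; first exact: measurable_powR_density.
  by do 2 apply: measurableT_comp => //; exact: measurable_funM.
- by move=> s _; rewrite lee_fin mulr_ge0 ?powR_density_ge0 ?expR_ge0.
- by rewrite lee_fin mulr_ge0 ?powR_density_ge0 ?powR_ge0.
rewrite integral_powR_density_expR// -!EFinM; congr EFin.
rewrite powRM ?(ltW l0) ?divr_ge0 ?(ltW m0) ?(ltW m1)//.
rewrite powRM ?invr_ge0 ?(ltW m0) ?(ltW m1)//.
rewrite -[(1 + m)^-1]m1V -powRrM.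
have -> : powR_density p m = powR_density (h - p) m * m `^ (- (h - 2 * p)).
  by rewrite powR_densityM; congr powR_density; ring.
have -> : (1 + m) `^ (- (2 * p)) = (1 + m) `^ (- h) * (1 + m) `^ (-1 * - (h - 2 * p)).
  rewrite -powRD ?(gt_eqF m1) ?implybT//; congr (_ `^ _); ring.
ring.
Qed.

End fubini_polar.

(** * Lebesgue measure on R^n *)

Section lebesgue_Rd_theory.
Variable R : realType.
Local Notation T := (measurableTypeR R).

Lemma integral_lebesgue_RdS n (f : n.+1.-tuple T -> \bar R) :
  measurable_fun setT f -> (forall x, 0 <= f x)%E ->
  (\int[lebesgue_Rd n.+1]_x f x =
   \int[lebesgue_measure]_x \int[lebesgue_Rd n]_t f (tuple_of_pair (x, t)))%E.
Proof.
move=> mf f0.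
have mt := @measurable_tuple_of_pair R n.
rewrite (@eq_measure_integral _ _ _ _
  (measure_function_pushforward__canonical__measure_function_Measure
    (lebesgue_measure \x lebesgue_Rd n)%E mt)) //.
rewrite ge0_integral_pushforward// preimage_setT.
rewrite (@fubini_tonelli1 _ _ _ _ _ _ _ (f \o @tuple_of_pair R n)) //=.
exact: measurableT_comp.
Qed.

(** Gaussians in the squared distance factor over the coordinates, so all kernels are expressed
    through it; [eucl_dist_powR] translates by halving exponents. *)
Definition sqdist n (x y : n.-tuple T) : R :=
  \sum_(i < n) (tnth x i - tnth y i : R) ^+ 2.

Lemma sqdist_ge0 n (x y : n.-tuple T) : 0 <= sqdist x y.
Proof. by apply: sumr_ge0 => i _; exact: sqr_ge0. Qed.

Lemma sqdistC n (x y : n.-tuple T) : sqdist x y = sqdist y x.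
Proof. by apply: eq_bigr => i _; rewrite -sqrrN opprB. Qed.

Lemma sqdist_eq0 n (x y : n.-tuple T) : (sqdist x y == 0) = (x == y).
Proof.
apply/idP/eqP => [|->]; last first.
  by rewrite /sqdist big1// => i _; rewrite subrr expr0n.
rewrite psumr_eq0 => [/allP xy|i _]; last exact: sqr_ge0.
apply: eq_from_tnth => i; apply/eqP.
by have := xy i (mem_index_enum _); rewrite /= sqrf_eq0 subr_eq0.
Qed.

Lemma sqdist_tuple_of_pair n (p q : T * n.-tuple T) :
  sqdist (tuple_of_pair p) (tuple_of_pair q) =
  (p.1 - q.1 : R) ^+ 2 + sqdist p.2 q.2.
Proof.
rewrite /sqdist big_ord_recl; congr (_ + _).
by apply: eq_bigr => i _; rewrite !tnthS.
Qed.

Lemma measurable_sqdist d0 (S : measurableType d0) n (f g : S -> n.-tuple T) :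
  measurable_fun setT f -> measurable_fun setT g ->
  measurable_fun setT (fun s => sqdist (f s) (g s)).
Proof.
move=> mf mg; rewrite /sqdist.
apply: measurable_sum => i; apply: measurable_funX.
apply: measurable_funB.
  by move/measurable_fun_tnthP : mf => /(_ i).
by move/measurable_fun_tnthP : mg => /(_ i).
Qed.

Lemma eucl_distE n (x y : n.-tuple T) : eucl_dist x y = sqdist x y `^ (2^-1).
Proof. by rewrite powR12_sqrt ?sqdist_ge0. Qed.

Lemma eucl_dist_powR n (x y : n.-tuple T) (p : R) :
  eucl_dist x y `^ p = sqdist x y `^ (p / 2).
Proof. by rewrite eucl_distE -powRrM mulrC. Qed.

Lemma integral_gaussR (s m : R) : 0 < s ->
  (\int[lebesgue_measure]_z (expR (- (s * (z - m) ^+ 2)))%:E =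
   (Num.sqrt (pi / s))%:E)%E.
Proof.
(* The standard deviation for which the normal density is proportional to exp(-s(z-m)^2). *)
move=> s0; pose v := Num.sqrt ((2 * s)^-1).
have v0 : 0 < v by rewrite sqrtr_gt0 invr_gt0 mulr_gt0.
have v2 : v ^+ 2 = (2 * s)^-1 by rewrite sqr_sqrtr// invr_ge0 mulr_ge0// ltW.
have := integral_normal_pdf m v.
rewrite normal_pdfE ?gt_eqF//.
have -> : (\int[lebesgue_measure]_x (normal_peak v * normal_fun m v x)%:E =
  (normal_peak v)%:E * \int[lebesgue_measure]_z (expR (- (s * (z - m) ^+ 2)))%:E)%E.
  rewrite -ge0_integralZl; [|by []| |by move=> *; rewrite lee_fin expR_ge0|]; last 2 first.
  - apply/measurable_EFinP; do 2 apply: measurableT_comp => //.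
    apply: measurable_funM => //; apply: measurable_funX; exact: measurable_funB.
  - by rewrite lee_fin normal_peak_ge0.
  - apply: eq_integral => x _; rewrite -EFinM /normal_fun.
    congr (_ * expR _)%:E; rewrite v2 -mulr_natr.
    by field; rewrite gt_eqF.
have -> : normal_peak v = (Num.sqrt (pi / s))^-1.
  rewrite /normal_peak v2; congr (Num.sqrt _)^-1.
  by rewrite -mulr_natr; field; rewrite gt_eqF.
have p0 : 0 < Num.sqrt (pi / s) by rewrite sqrtr_gt0 divr_gt0 ?pi_gt0.
move=> /(congr1 (fun z => (Num.sqrt (pi / s))%:E * z)%E).
by rewrite muleA -EFinM divff ?gt_eqF// mul1e mule1.
Qed.

Lemma integral_gaussR_prod (s t x y : R) : 0 < s -> 0 < t ->
  (\int[lebesgue_measure]_z (expR (- (s * (x - z) ^+ 2 + t * (y - z) ^+ 2)))%:E =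
   (Num.sqrt (pi / (s + t)) * expR (- (s * t / (s + t) * (x - y) ^+ 2)))%:E)%E.
Proof.
move=> s0 t0; have st0 : 0 < s + t by rewrite addr_gt0.
(* Completing the square: the product is a Gaussian of parameter s + t around the weighted mean of x
   and y, times a factor free of z. *)
rewrite EFinM -(@integral_gaussR (s + t) ((s * x + t * y) / (s + t)))//.
rewrite muleC -ge0_integralZl//.
- apply: eq_integral => z _; rewrite -EFinM -expRD; congr (expR _)%:E.
  by field; rewrite gt_eqF.
- apply/measurable_EFinP; do 2 apply: measurableT_comp => //.
  apply: measurable_funM => //; apply: measurable_funX; exact: measurable_funB.
Qed.

Lemma measurable_gauss2 n (s t : R) (x y : n.-tuple T) :
  measurable_fun setT (fun z => (expR (- (s * sqdist x z + t * sqdist y z)))%:E).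
Proof.
apply/measurable_EFinP; do 2 apply: measurableT_comp => //.
by apply: measurable_funD; apply: measurable_funM => //; exact: measurable_sqdist.
Qed.

(** The rule for composing Gaussians, by induction over the coordinates; in dimension 0 the measure
    is a unit point mass, so both sides are 1. *)
Lemma integral_gauss_prod n (s t : R) (x y : n.-tuple T) : 0 < s -> 0 < t ->
  (\int[lebesgue_Rd n]_z (expR (- (s * sqdist x z + t * sqdist y z)))%:E =
   (Num.sqrt (pi / (s + t)) ^+ n *
    expR (- (s * t / (s + t) * sqdist x y)))%:E)%E.
Proof.
move=> s0 t0; elim: n x y => [|n IH] x y.
  rewrite /= integral_dirac//; last exact: measurable_gauss2.
  by rewrite diracT mul1e /sqdist !big_ord0 !mulr0 addr0 oppr0 expR0 mulr1.
rewrite integral_lebesgue_RdS//; last exact: measurable_gauss2.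
rewrite -(pair_of_tupleK x) -(pair_of_tupleK y).
case: (pair_of_tuple x) (pair_of_tuple y) => x0 x' [y0 y'].
transitivity (\int[lebesgue_measure]_z
   ((expR (- (s * (x0 - z) ^+ 2 + t * (y0 - z) ^+ 2)))%:E *
   (Num.sqrt (pi / (s + t)) ^+ n * expR (- (s * t / (s + t) * sqdist x' y')))%:E))%E.
  apply: eq_integral => z _; rewrite -IH -ge0_integralZl//; last exact: measurable_gauss2.
  apply: eq_integral => z' _; rewrite !sqdist_tuple_of_pair/= -EFinM -expRD.
  by congr (expR _)%:E; ring.
rewrite ge0_integralZr//; last first.
  apply/measurable_EFinP; do 2 apply: measurableT_comp => //.
  by apply: measurable_funD; apply: measurable_funM => //;
    apply: measurable_funX; exact: measurable_funB.
rewrite integral_gaussR_prod// sqdist_tuple_of_pair/= mulrDr opprD expRD (exprS _ n).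
by rewrite -EFinM; congr EFin; ring.
Qed.

Lemma lebesgue_Rd_hyperplane n (i : 'I_n) (a : R) :
  lebesgue_Rd n [set x | tnth x i = a] = 0%E.
Proof.
(* The hyperplane is a box with one side reduced to a point; the other sides have infinite length,
   and 0 times infinity is 0. *)
pose A (j : 'I_n) : set T := if j == i then [set a] else setT.
have mA j : measurable (A j) by rewrite /A; case: ifP.
have -> : [set x : n.-tuple T | tnth x i = a] = [set x | forall j, A j (tnth x j)].
  apply/seteqP; split => x /=; first by move=> xa j; rewrite /A; case: eqP => // ->.
  by move=> /(_ i); rewrite /A eqxx.
rewrite lebesgue_Rd_box// (bigD1 i)//= /A eqxx lebesgue_measure_set1.
by rewrite mul0e.
Qed.

Lemma measurable_hyperplane n (i : 'I_n) (a : R) :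
  measurable [set x : n.-tuple T | tnth x i = a].
Proof.
have : measurable (setT `&` (@tnth n T ^~ i) @^-1` [set a]).
  exact: measurable_tnth.
by rewrite setTI.
Qed.

(** A point lies in a hyperplane as soon as there is a coordinate. In dimension 0 the measure is a
    point mass and the statement fails. *)
Lemma ae_lebesgue_Rd_neq n (y : n.-tuple T) : (0 < n)%N ->
  {ae lebesgue_Rd n, forall x, x <> y}.
Proof.
case: n y => // n y _; exists [set x | tnth x ord0 = tnth y ord0]; split.
- exact: measurable_hyperplane.
- exact: lebesgue_Rd_hyperplane.
- by move=> x /= /contrapT ->.
Qed.

End lebesgue_Rd_theory.

(** * Energies of factorized kernels *)

Section measurable_integral.
Context d1 d2 (X : measurableType d1) (Z : measurableType d2) (R : realType).
Variable mu : {sigma_finite_measure set X -> \bar R}.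

Lemma measurable_fun_integral1 (F : X * Z -> \bar R) :
  measurable_fun setT F -> measurable_fun setT (fun z => \int[mu]_x F (x, z))%E.
Proof.
move=> mF.
under eq_fun do rewrite integralE.
apply: emeasurable_funB.
  rewrite (_ : (fun z => _) = (fun z => \int[mu]_x F^\+ (x, z))%E).
    by apply: measurable_fun_fubini_tonelli_G => //; exact: measurable_funepos.
  by apply/funext => z; apply: eq_integral => x _; rewrite !funeposE.
rewrite (_ : (fun z => _) = (fun z => \int[mu]_x F^\- (x, z))%E).
  by apply: measurable_fun_fubini_tonelli_G => //; exact: measurable_funeneg.
by apply/funext => z; apply: eq_integral => x _; rewrite !funenegE.
Qed.

(** If c = 0 both sides vanish even when h is not integrable; otherwise h inherits integrability.
    This pulls potentials out of products without knowing that they converge. *)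
Lemma integral_scale_Rintegral (h : X -> R) (c : R) :
  mu.-integrable setT (fun x => (h x * c)%:E) ->
  (\int[mu]_x (h x * c)%:E = ((\int[mu]_x h x)%R * c)%:E)%E.
Proof.
have [->|c0 ih] := eqVneq c 0.
  by move=> _; rewrite mulr0 integral0_eq// => x _; rewrite mulr0.
have hi : mu.-integrable setT (EFin \o h).
  have := integrableZr measurableT c^-1 ih.
  by apply: eq_integrable => // x _; rewrite /= -EFinM mulfK.
under eq_integral do rewrite EFinM.
rewrite (integralZr measurableT hi) EFinM /Rintegral fineK//.
exact: integrable_fin_num.
Qed.

Lemma le_abse_Rintegral (h : X -> R) : measurable_fun setT h ->
  (`|\int[mu]_x h x|%:E <= \int[mu]_x `|h x|%:E)%E.
Proof.
move=> mh; have mh' : measurable_fun setT (EFin \o h) by exact/measurable_EFinP.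
apply: le_trans (le_abse_integral mu measurableT mh').
rewrite /Rintegral; move: (integral _ _ _) => [r| |] //=; by rewrite normr0 ?lee_fin ?leey.
Qed.

End measurable_integral.

Section kernel_energy.
Context d1 d2 (X : measurableType d1) (Z : measurableType d2) (R : realType).
Variable mu : {sigma_finite_measure set X -> \bar R}.
Variable nu : {sigma_finite_measure set Z -> \bar R}.
Variables (k : X -> Z -> R) (K : X -> X -> R).
Hypothesis k0 : forall x z, 0 <= k x z.
Hypothesis K0 : forall x y, 0 <= K x y.
Hypothesis mk : measurable_fun setT (fun p : X * Z => k p.1 p.2).
Hypothesis mK : measurable_fun setT (fun p : X * X => K p.1 p.2).
(** Only almost every x is asked for: on the diagonal the Riesz kernels take a default value, and
    the factorization breaks down there. *)
Hypothesis kkK : forall y, {ae mu, forall x,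
  (K x y)%:E = (\int[nu]_z (k x z * k y z)%:E)%E}.
Implicit Types f g : X -> R.

Let mk1 z : measurable_fun setT (k ^~ z).
Proof. exact: (measurable_fun_pair1 z mk). Qed.

Let mk2 x : measurable_fun setT (k x).
Proof. exact: (measurable_fun_pair2 x mk). Qed.

Let mK1 y : measurable_fun setT (K ^~ y).
Proof. exact: (measurable_fun_pair1 y mK). Qed.

(* potential f z is meaningful only where epotential (abs f) z is finite. *)
Definition potential f z : R := \int[mu]_x (f x * k x z).

Definition epotential f z : \bar R := (\int[mu]_x (f x * k x z)%:E)%E.

Lemma epotential_ge0 f z : (forall x, 0 <= f x) -> (0 <= epotential f z)%E.
Proof. by move=> f0; apply: integral_ge0 => x _; rewrite lee_fin mulr_ge0. Qed.

Let mfk f : measurable_fun setT f ->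
  measurable_fun setT (fun p : X * Z => (f p.1 * k p.1 p.2)%:E).
Proof.
by move=> mf; apply/measurable_EFinP/measurable_funM => //; exact: measurableT_comp.
Qed.

Lemma measurable_epotential f : measurable_fun setT f ->
  measurable_fun setT (epotential f).
Proof. by move=> mf; exact: (measurable_fun_integral1 mu (mfk mf)). Qed.

Lemma measurable_potential f : measurable_fun setT f ->
  measurable_fun setT (potential f).
Proof.
move=> mf; apply: (measurableT_comp (f := fine)); first exact: fine_measurable.
exact: measurable_epotential.
Qed.

Lemma le_potential f z : measurable_fun setT f ->
  (`|potential f z|%:E <= epotential (fun x => `|f x|%R) z)%E.
Proof.
move=> mf; apply: le_trans (le_abse_Rintegral _ _) _.
  by apply: measurable_funM.
rewrite le_eqVlt; apply/orP; left; apply/eqP; apply: eq_integral => x _.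
by rewrite normrM (ger0_norm (k0 _ _)).
Qed.

(** Insert [kkK] and move the z-integral outermost by two applications of Tonelli; the integrals in
    x and y then separate. *)
Lemma kernel_energyE f g : measurable_fun setT f -> measurable_fun setT g ->
  (forall x, 0 <= f x) -> (forall x, 0 <= g x) ->
  (\int[mu]_y \int[mu]_x (f x * g y * K x y)%:E =
   \int[nu]_z (epotential f z * epotential g z))%E.
Proof.
move=> mf mg f0 g0.
transitivity (\int[mu]_y \int[nu]_z ((g y * k y z)%:E * epotential f z))%E.
  apply: eq_integral => y _.
  transitivity (\int[mu]_x \int[nu]_z ((g y * k y z)%:E * (f x * k x z)%:E))%E.
    apply: ge0_ae_eq_integral => //.
    - apply/measurable_EFinP/measurable_funM => //.
      exact: measurable_funM.
    - apply: (@measurable_fun_fubini_tonelli_F _ _ _ _ _ _ (fun p : X * Z =>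
        (g y * k y p.2)%:E * (f p.1 * k p.1 p.2)%:E)%E).
      + apply: emeasurable_funM; last exact: mfk.
        apply/measurable_EFinP/measurable_funM => //.
        exact: measurableT_comp.
      + by move=> p; rewrite -EFinM lee_fin !mulr_ge0.
    - by move=> x _; rewrite lee_fin !mulr_ge0.
    - by move=> x _; apply: integral_ge0 => z _; rewrite -EFinM lee_fin !mulr_ge0.
    - apply: filterS (kkK y) => x Kxy _.
      rewrite EFinM Kxy -ge0_integralZl//; last 3 first.
      + by apply/measurable_EFinP/measurable_funM.
      + by move=> z _; rewrite lee_fin mulr_ge0.
      + by rewrite lee_fin mulr_ge0.
      by apply: eq_integral => z _; rewrite -!EFinM; congr EFin; ring.
  rewrite (fubini_tonelli (fun p : X * Z =>
        (g y * k y p.2)%:E * (f p.1 * k p.1 p.2)%:E)%E).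
  - apply: eq_integral => z _ /=; rewrite ge0_integralZl//.
    + by apply/measurable_EFinP/measurable_funM.
    + by move=> x _; rewrite lee_fin mulr_ge0.
    + by rewrite lee_fin mulr_ge0.
  - apply: emeasurable_funM; last exact: mfk.
    apply/measurable_EFinP/measurable_funM => //.
    exact: measurableT_comp.
  - by move=> p; rewrite -EFinM lee_fin !mulr_ge0.
rewrite (fubini_tonelli (fun p : X * Z =>
        (g p.1 * k p.1 p.2)%:E * epotential f p.2)%E).
- apply: eq_integral => z _ /=; rewrite ge0_integralZr//.
  + by rewrite muleC.
  + by apply/measurable_EFinP/measurable_funM.
  + by move=> x _; rewrite lee_fin mulr_ge0.
  + exact: epotential_ge0.
- apply: emeasurable_funM; first exact: mfk.
  by apply: measurableT_comp => //; exact: measurable_epotential.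
- by move=> p; rewrite mule_ge0 ?epotential_ge0// lee_fin mulr_ge0.
Qed.

(** * The bilinear form on signed functions of finite energy *)

Section signed.
Variables f g : X -> R.
Hypotheses (mf : measurable_fun setT f) (mg : measurable_fun setT g).
Hypothesis fgoo :
  (\int[mu]_y \int[mu]_x (`|f x| * `|g y| * K x y)%:E < +oo)%E.

Lemma integrable_kernel : (mu \x mu)%E.-integrable setT
  (fun p => (f p.1 * g p.2 * K p.1 p.2)%:E).
Proof.
apply/integrable21ltyP.
  apply/measurable_EFinP/measurable_funM => //.
  by apply: measurable_funM; exact: measurableT_comp.
rewrite (eq_integral (fun y => \int[mu]_x (`|f x| * `|g y| * K x y)%:E)%E)//.
move=> y _; apply: eq_integral => x _.
by rewrite /= 2!normrM (ger0_norm (K0 _ _)).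
Qed.

Lemma integrable_kernel_form : mu.-integrable setT
  (fun y => \int[mu]_x (f x * g y * K x y)%:E)%E.
Proof.
apply/integrableP; split; first exact: (measurable_fubini_G integrable_kernel).
apply: le_lt_trans fgoo; apply: ge0_le_integral => //.
- by apply: measurableT_comp => //; exact: (measurable_fubini_G integrable_kernel).
- apply: (@measurable_fun_fubini_tonelli_G _ _ _ _ _ _
    (fun p : X * X => (`|f p.1| * `|g p.2| * K p.1 p.2)%:E)) => [|p].
    apply/measurable_EFinP/measurable_funM => //.
    by apply: measurable_funM; do 2 apply: measurableT_comp => //.
  by rewrite lee_fin !mulr_ge0.
- move=> y _; apply: le_trans (le_abse_integral mu measurableT _) _.
    by apply/measurable_EFinP/measurable_funM => //; exact: measurable_funM.
  rewrite le_eqVlt; apply/orP; left; apply/eqP; apply: eq_integral => x _.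
  by rewrite /= 2!normrM (ger0_norm (K0 _ _)).
Qed.

(** The integrand once x has been integrated out. It splits the argument into Fubini for the pair
    (x, z) at fixed y and Fubini for the pair (y, z), so that no triple product measure is
    needed. *)
Let inner_potential (y : X) (z : Z) : R := g y * k y z * potential f z.

Let m_inner : measurable_fun setT (fun p : X * Z => (inner_potential p.1 p.2)%:E).
Proof.
apply/measurable_EFinP/measurable_funM.
  by apply: measurable_funM => //; exact: measurableT_comp.
by apply: measurableT_comp; first exact: measurable_potential.
Qed.

(** The absolute value is dominated by the same expression for |f| and |g|, whose integral is their
    energy by [kernel_energyE]. *)
Let integrable_inner : (mu \x nu)%E.-integrable setT
  (fun p => (inner_potential p.1 p.2)%:E).
Proof.
apply/integrable21ltyP => //; apply: le_lt_trans fgoo.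
rewrite kernel_energyE//; try by exact: measurableT_comp.
apply: ge0_le_integral => //.
- by move=> z _; apply: integral_ge0.
- apply: (@measurable_fun_fubini_tonelli_G _ _ _ _ _ _
    (fun p : X * Z => `|(inner_potential p.1 p.2)%:E|)%E) => //.
  exact: measurableT_comp.
- by apply: emeasurable_funM; apply: measurable_epotential; exact: measurableT_comp.
- move=> z _.
  rewrite (eq_integral (fun y => (`|potential f z|%:E * (`|g y| * k y z)%:E)%E)).
    rewrite ge0_integralZl//.
    + by rewrite lee_wpmul2r ?le_potential// epotential_ge0.
    + apply/measurable_EFinP/measurable_funM => //; exact: measurableT_comp.
    + by move=> y _; rewrite lee_fin mulr_ge0.
  move=> y _; rewrite /inner_potential /= !normrM (ger0_norm (k0 _ _)) -EFinM.
  by rewrite [in RHS]mulrC.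
Qed.

Let integral_inner_z : {ae mu, forall y,
  (\int[nu]_z (inner_potential y z)%:E = \int[mu]_x (f x * g y * K x y)%:E)%E}.
Proof.
have := ae_integrable2 integrable_kernel; apply: filterS => y /= iy.
have [gy0|gy0] := eqVneq (g y) 0.
  rewrite !integral0_eq// => [x|z] _; rewrite /inner_potential gy0 ?(mulr0, mul0r)//.
pose P (p : X * Z) := (f p.1 * k p.1 p.2 * (g y * k y p.2))%:E.
have mP : measurable_fun setT P.
  apply/measurable_EFinP/measurable_funM; apply: measurable_funM => //;
    exact: measurableT_comp.
have aePK (h : X -> R) : measurable_fun setT h -> (forall x, 0 <= h x) ->
    {ae mu, forall x, (\int[nu]_z (h x * k x z * k y z)%:E = (h x * K x y)%:E)%E}.
  move=> mh h0; apply: filterS (kkK y) => x Kxy.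
  rewrite EFinM Kxy -ge0_integralZl//; last 3 first.
  + by apply/measurable_EFinP/measurable_funM.
  + by move=> z _; rewrite lee_fin mulr_ge0.
  + by rewrite lee_fin.
  by apply: eq_integral => z _; rewrite -EFinM mulrA.
have iP : (mu \x nu)%E.-integrable setT P.
  apply/integrable12ltyP => //.
  move/integrableP : iy => [_]; apply: le_lt_trans.
  rewrite le_eqVlt; apply/orP; left; apply/eqP.
  apply: ge0_ae_eq_integral => //.
  - apply: (@measurable_fun_fubini_tonelli_F _ _ _ _ _ _ (abse \o P)) => [|p].
      exact: measurableT_comp.
    exact: abse_ge0.
  - apply: measurableT_comp => //; apply/measurable_EFinP/measurable_funM => //.
    exact: measurable_funM.
  - by move=> x _; exact: integral_ge0.
  - have mh : measurable_fun setT (fun x => `|f x * g y|).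
      by apply: measurableT_comp => //; exact: measurable_funM.
    apply: filterS (aePK _ mh (fun=> normr_ge0 _)) => x hx _.
    rewrite /= normrM (ger0_norm (K0 _ _)) -hx; apply: eq_integral => z _.
    rewrite /P /= !normrM (ger0_norm (k0 _ _)) (ger0_norm (k0 _ _)).
    by congr EFin; ring.
transitivity (\int[nu]_z \int[mu]_x P (x, z))%E.
  apply: ae_eq_integral => //.
  - by apply/measurable_EFinP; apply: measurable_funM;
      [exact: measurable_funM|exact: measurable_potential].
  - exact: (measurable_fun_integral1 mu mP).
  - apply: filterS (ae_integrable2 iP) => z /= iz _.
    rewrite /P /= in iz *.
    by rewrite (integral_scale_Rintegral iz) /inner_potential mulrC.
rewrite -(Fubini iP).
apply: ae_eq_integral => //.
- by apply: (measurable_int mu); exact: (integrable_fubini_F iP).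
- by apply/measurable_EFinP/measurable_funM => //; exact: measurable_funM.
- apply: filterS (kkK y) => x Kxy _.
  rewrite /P /=.
  have [fx0|fx0] := eqVneq (f x) 0.
    rewrite fx0 !mul0r integral0_eq// => z _; by rewrite !mul0r.
  under eq_integral do rewrite mulrACA EFinM.
  rewrite (@integralZl _ _ _ nu setT measurableT (fun z => (k x z * k y z)%:E)).
    by rewrite -Kxy.
  apply/integrableP; split; first exact/measurable_EFinP/measurable_funM.
  rewrite (eq_integral (fun z => (k x z * k y z)%:E)).
    by rewrite -Kxy ltry.
  by move=> z _; rewrite gee0_abs// lee_fin mulr_ge0.
Qed.

Let integral_inner_y : {ae nu, forall z,
  (\int[mu]_y (inner_potential y z)%:E = (potential f z * potential g z)%:E)%E}.
Proof.
apply: filterS (ae_integrable2 integrable_inner) => z iz.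
rewrite /inner_potential /= in iz *.
by rewrite (integral_scale_Rintegral iz) mulrC.
Qed.

Lemma integrable_potentialM : nu.-integrable setT
  (fun z => (potential f z * potential g z)%:E).
Proof.
have mP : measurable_fun setT (fun z => (potential f z * potential g z)%:E).
  by apply/measurable_EFinP/measurable_funM; exact: measurable_potential.
apply/integrableP; split => //; apply: le_lt_trans fgoo.
rewrite kernel_energyE//; try by exact: measurableT_comp.
apply: ge0_le_integral => //.
- exact: measurableT_comp.
- by apply: emeasurable_funM; apply: measurable_epotential; exact: measurableT_comp.
- move=> z _; rewrite /= normrM EFinM.
  by apply: lee_pmul; rewrite ?lee_fin ?le_potential.
Qed.

Lemma kernel_form_potential :
  (\int[mu]_y \int[mu]_x (f x * g y * K x y)%:E =
   \int[nu]_z (potential f z * potential g z)%:E)%E.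
Proof.
transitivity (\int[mu]_y \int[nu]_z (inner_potential y z)%:E)%E.
  apply: ae_eq_integral => //.
  - exact: (measurable_int mu integrable_kernel_form).
  - apply: (measurable_int mu).
    exact: (integrable_fubini_F integrable_inner).
  - by apply: filterS integral_inner_z => y ->.
rewrite (Fubini integrable_inner).
apply: ae_eq_integral => //.
- exact: (measurable_fubini_G integrable_inner).
- exact: (measurable_int nu integrable_potentialM).
- by apply: filterS integral_inner_y => y ->.
Qed.

End signed.

End kernel_energy.

(** * Riesz kernels *)

Section riesz_kernel.
Variables (R : realType) (n : nat).
Local Notation T := (measurableTypeR R).
Local Notation Rn := (n.-tuple T).
Local Notation mu := (@lebesgue_Rd R n).
Local Notation h := (n%:R / 2 : R).

Definition riesz_kernel (e : R) (x y : Rn) : R := sqdist x y `^ (- e).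

Lemma riesz_kernel_ge0 e x y : 0 <= riesz_kernel e x y.
Proof. exact: powR_ge0. Qed.

Lemma riesz_kernelC e x y : riesz_kernel e x y = riesz_kernel e y x.
Proof. by rewrite /riesz_kernel sqdistC. Qed.

Lemma measurable_riesz_kernel e d0 (S : measurableType d0) (f g : S -> Rn) :
  measurable_fun setT f -> measurable_fun setT g ->
  measurable_fun setT (fun s => riesz_kernel e (f s) (g s)).
Proof.
by move=> mf mg; apply: (measurableT_comp (measurable_powR _)); exact: measurable_sqdist.
Qed.

Lemma sqdist_gt0 (x y : Rn) : x <> y -> 0 < sqdist x y.
Proof. by move=> /eqP xy; rewrite lt_neqAle sqdist_ge0 eq_sym sqdist_eq0 xy. Qed.

Lemma riesz_kernel_gamma (e : R) x y : 0 < e -> x <> y ->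
  ((riesz_kernel e x y * Gamma e)%:E =
   \int[lebesgue_measure]_s (powR_density e s * expR (- (s * sqdist x y)))%:E)%E.
Proof.
move=> e0 /sqdist_gt0 xy; rewrite -(integral_powR_density_expR e0 xy).
by apply: eq_integral => s _; rewrite (mulrC s).
Qed.

Lemma sqrt_powR_half (s : R) : 0 <= s -> Num.sqrt s ^+ n = s `^ h.
Proof.
move=> s0; rewrite -powR12_sqrt// -powR_mulrn ?powR_ge0// -powRrM.
by congr (_ `^ _); rewrite mulrC.
Qed.

(** The constant of the semigroup law for |x|^(2p-n), as produced by the Gaussian computation;
    [riesz_gammaM] rewrites it as gamma_n(2p)^2 / gamma_n(4p). *)
Definition riesz_constant (p : R) : R :=
  pi `^ h * (Gamma (h - 2 * p) * (Gamma p ^+ 2 / Gamma (2 * p))) /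
  Gamma (h - p) ^+ 2.

Let F (p : R) (x y z : Rn) (s t : R) : R :=
  powR_density (h - p) s * powR_density (h - p) t *
  expR (- (s * sqdist x z + t * sqdist y z)).

Let F0 p x y z s t : 0 <= F p x y z s t.
Proof. by rewrite mulr_ge0 ?expR_ge0// mulr_ge0 ?powR_density_ge0. Qed.

Let mF p x y d0 (S : measurableType d0) (z : S -> Rn) (s t : S -> R) :
  measurable_fun setT z -> measurable_fun setT s -> measurable_fun setT t ->
  measurable_fun setT (fun w => (F p x y (z w) (s w) (t w))%:E).
Proof.
move=> mz ms mt; apply/measurable_EFinP; apply: measurable_funM.
  by apply: measurable_funM; apply: (measurableT_comp (measurable_powR_density _)).
do 2 apply: measurableT_comp => //.
by apply: measurable_funD; apply: measurable_funM => //; exact: measurable_sqdist.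
Qed.

Let swapF p x y :
  (\int[mu]_z \int[lebesgue_measure]_s \int[lebesgue_measure]_t (F p x y z s t)%:E =
   \int[lebesgue_measure]_s \int[lebesgue_measure]_t \int[mu]_z (F p x y z s t)%:E)%E.
Proof.
rewrite (fubini_tonelli (fun w : Rn * T =>
  \int[lebesgue_measure]_t (F p x y w.1 w.2 t)%:E)%E).
- apply: eq_integral => s _ /=.
  rewrite (fubini_tonelli (fun w : Rn * T => (F p x y w.1 s w.2)%:E)) //.
    exact: mF.
  by move=> w; rewrite lee_fin.
- apply: (@measurable_fun_fubini_tonelli_F _ _ _ _ _ _
    (fun w : (Rn * T) * T => (F p x y w.1.1 w.1.2 w.2)%:E)) => [|w].
    by apply: mF => //; apply: measurableT_comp.
  by rewrite lee_fin.
- by move=> w; apply: integral_ge0 => t _; rewrite lee_fin.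
Qed.

(** Write both kernels as Gamma integrals of Gaussians and integrate in z first.
    [integral_gauss_prod] gives (pi/(s+t))^h exp(-st/(s+t) |x-y|^2), and the remaining integral in
    (s, t) is [integral_harmonic_expR]. *)
Lemma riesz_composition (p : R) (x y : Rn) : (0 < n)%N -> 0 < p ->
  0 < h - 2 * p -> x <> y ->
  (\int[mu]_z (riesz_kernel (h - p) x z * riesz_kernel (h - p) y z)%:E =
   (riesz_constant p * riesz_kernel (h - 2 * p) x y)%:E)%E.
Proof.
move=> n0 p0 hp0 xy.
have a0 : 0 < h - p by apply: (lt_trans hp0); lra.
have Ga0 := Gamma_gt0 a0.
have mkk : measurable_fun setT (fun z : Rn =>
    (riesz_kernel (h - p) x z * riesz_kernel (h - p) y z)%:E).
  by apply/measurable_EFinP; apply: measurable_funM; exact: measurable_riesz_kernel.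
have I : ((Gamma (h - p) ^+ 2)%:E * \int[mu]_z (riesz_kernel (h - p) x z * riesz_kernel (h - p) y z)%:E =
   (riesz_kernel (h - 2 * p) x y *
    (pi `^ h * (Gamma (h - 2 * p) * (Gamma p ^+ 2 / Gamma (2 * p)))))%:E)%E.
  rewrite -ge0_integralZl//; last 2 first.
  - by move=> z _; rewrite lee_fin mulr_ge0 ?riesz_kernel_ge0.
  - by rewrite lee_fin exprn_ge0// ltW.
  transitivity (\int[mu]_z \int[lebesgue_measure]_s \int[lebesgue_measure]_t
      (F p x y z s t)%:E)%E.
    apply: ge0_ae_eq_integral => //.
    - exact: emeasurable_funM.
    - apply: (@measurable_fun_fubini_tonelli_F _ _ _ _ _ _
        (fun w : Rn * T => \int[lebesgue_measure]_t (F p x y w.1 w.2 t)%:E)%E) => [|w].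
        apply: (@measurable_fun_fubini_tonelli_F _ _ _ _ _ _
          (fun w : (Rn * T) * T => (F p x y w.1.1 w.1.2 w.2)%:E)) => [|w].
          by apply: mF => //; apply: measurableT_comp.
        by rewrite lee_fin.
      by apply: integral_ge0 => t _; rewrite lee_fin.
    - move=> z _; rewrite -EFinM lee_fin mulr_ge0 ?exprn_ge0 ?(ltW Ga0)//.
      by rewrite mulr_ge0 ?riesz_kernel_ge0.
    - by move=> z _; do 2 (apply: integral_ge0 => ? _); rewrite lee_fin.
    (* The Gamma representation fails at z = x and z = y, where the kernel has a default value, so
       it is used for almost every z. *)
    - have := ae_lebesgue_Rd_neq y n0; have := ae_lebesgue_Rd_neq x n0.
      apply: filterS2 => z /nesym zx /nesym zy _.
      transitivity ((riesz_kernel (h - p) x z * Gamma (h - p))%:E *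
                    (riesz_kernel (h - p) y z * Gamma (h - p))%:E)%E.
        by rewrite -!EFinM; congr EFin; ring.
      rewrite (riesz_kernel_gamma a0 zx) -ge0_integralZr//; last 3 first.
      + apply/measurable_EFinP/measurable_funM; first exact: measurable_powR_density.
        by do 2 apply: measurableT_comp => //; exact: measurable_funM.
      + by move=> s _; rewrite lee_fin mulr_ge0 ?powR_density_ge0 ?expR_ge0.
      + by rewrite lee_fin mulr_ge0 ?riesz_kernel_ge0 ?(ltW Ga0).
      apply: eq_integral => s _.
      rewrite (riesz_kernel_gamma a0 zy) -ge0_integralZl//; last 3 first.
      + apply/measurable_EFinP/measurable_funM; first exact: measurable_powR_density.
        by do 2 apply: measurableT_comp => //; exact: measurable_funM.
      + by move=> t _; rewrite lee_fin mulr_ge0 ?powR_density_ge0 ?expR_ge0.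
      + by rewrite lee_fin mulr_ge0 ?powR_density_ge0 ?expR_ge0.
      apply: eq_integral => t _; rewrite -EFinM /F opprD expRD.
      by congr EFin; ring.
  rewrite swapF.
  transitivity (\int[lebesgue_measure]_s \int[lebesgue_measure]_t
     ((pi `^ h)%:E * (powR_density (h - p) s * powR_density (h - p) t *
      ((s + t) `^ (- h) *
       expR (- (s * t * (s + t) `^ (-1) * sqdist x y))))%:E))%E.
    apply: eq_integral => s _; apply: eq_integral => t _.
    have [s0|s0] := leP s 0.
      rewrite powR_density0// !mul0r mule0 integral0_eq// => z _.
      by rewrite /F powR_density0// !mul0r.
    have [t0|t0] := leP t 0.
      rewrite (powR_density0 _ t0)// mulr0 !mul0r mule0 integral0_eq// => z _.
      by rewrite /F (powR_density0 _ t0) mulr0 !mul0r.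
    have st0 : 0 < s + t by rewrite addr_gt0.
    rewrite /F.
    under eq_integral do rewrite EFinM.
    rewrite ge0_integralZl//; last 2 first.
    - exact: measurable_gauss2.
    - by rewrite lee_fin mulr_ge0 ?powR_density_ge0.
    rewrite integral_gauss_prod// sqrt_powR_half ?divr_ge0 ?pi_ge0 ?(ltW st0)//.
    rewrite powRM ?pi_ge0 ?invr_ge0 ?(ltW st0)// -[in LHS](powR_inv1 (ltW st0)).
    rewrite -powRrM mulN1r -!EFinM; congr EFin; ring.
  have mG : measurable_fun setT (fun w : T * T =>
      (powR_density (h - p) w.1 * powR_density (h - p) w.2 *
      ((w.1 + w.2) `^ (- h) *
       expR (- (w.1 * w.2 * (w.1 + w.2) `^ (-1) * sqdist x y))))%:E).
    have mD : measurable_fun setT (fun x : T * T => x.1 + x.2 : T).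
      exact: measurable_funD.
    apply/measurable_EFinP; apply: measurable_funM; first apply: measurable_funM.
    + by apply: measurableT_comp; first exact: measurable_powR_density.
    + by apply: measurableT_comp; first exact: measurable_powR_density.
    + apply: measurable_funM; first exact: (measurableT_comp (measurable_powR _)).
      do 2 apply: measurableT_comp => //; apply: measurable_funM => //.
      apply: measurable_funM; first exact: measurable_funM.
      exact: (measurableT_comp (measurable_powR _)).
  have G0 (s t : T) : (0 <= (powR_density (h - p) s * powR_density (h - p) t *
      ((s + t) `^ (- h) *
       expR (- (s * t * (s + t) `^ (-1) * sqdist x y))))%:E)%E.
    by rewrite lee_fin mulr_ge0 ?mulr_ge0 ?expR_ge0 ?powR_ge0 ?powR_density_ge0.
  under eq_integral => s _.
    rewrite ge0_integralZl//; last 2 first.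
    - exact: (measurable_fun_pair2 s mG).
    - by rewrite lee_fin powR_ge0.
    over.
  rewrite ge0_integralZl//; last 3 first.
  - exact: (@measurable_fun_fubini_tonelli_F _ _ _ _ _ _ _ mG (fun w => G0 w.1 w.2)).
  - by move=> s _; apply: integral_ge0.
  - by rewrite lee_fin powR_ge0.
  rewrite integral_harmonic_expR// ?sqdist_gt0// -EFinM /riesz_kernel.
  move: (Gamma _) (Gamma _) (Gamma _) => A B C.
  by congr EFin; ring.
have := congr1 (fun z => ((Gamma (h - p) ^+ 2)^-1)%:E * z)%E I.
rewrite muleA -EFinM mulVf ?mul1e; last by rewrite expf_neq0// gt_eqF.
move=> ->; rewrite -EFinM /riesz_constant.
by move: (Gamma _) (Gamma _) (Gamma _) => A B C; congr EFin; ring.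
Qed.

Lemma riesz_constant_gt0 (p : R) : 0 < p -> 0 < h - 2 * p -> 0 < riesz_constant p.
Proof.
move=> p0 hp0; have a0 : 0 < h - p by apply: (lt_trans hp0); lra.
rewrite divr_gt0 ?exprn_gt0 ?Gamma_gt0// !mulr_gt0 ?powR_gt0 ?pi_gt0 ?Gamma_gt0//.
by rewrite invr_gt0 Gamma_gt0// mulr_gt0.
Qed.

(** The law I_(2p) I_(2p) = I_(4p) at the level of normalizing constants. *)
Lemma riesz_gammaM (p : R) : 0 < p -> 0 < h - 2 * p ->
  riesz_constant p * riesz_gamma n (4 * p) = riesz_gamma n (2 * p) ^+ 2.
Proof.
move=> p0 hp0; have a0 : 0 < h - p by apply: (lt_trans hp0); lra.
rewrite /riesz_gamma /riesz_constant.
rewrite (_ : Gamma (4 * p / 2) = Gamma (2 * p)); last by congr Gamma; lra.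
rewrite (_ : Gamma (2 * p / 2) = Gamma p); last by congr Gamma; lra.
rewrite (_ : Gamma ((n%:R - 4 * p) / 2) = Gamma (h - 2 * p)); last by congr Gamma; lra.
rewrite (_ : Gamma ((n%:R - 2 * p) / 2) = Gamma (h - p)); last by congr Gamma; lra.
rewrite (_ : 2 `^ (4 * p) = 2 `^ (2 * p) ^+ 2); last first.
  by rewrite -powR_mulrn ?powR_ge0// -powRrM; congr (_ `^ _); ring.
have g1 := Gamma_gt0 hp0; have g2 := Gamma_gt0 a0.
have p20 : 0 < 2 * p by rewrite mulr_gt0.
have g3 := Gamma_gt0 p20.
move: (Gamma _) (Gamma _) (Gamma _) (Gamma _) (_ `^ (2 * p)) (pi `^ _) g1 g2 g3.
by move=> A B C D U W A0 C0 D0; field; rewrite !gt_eqF.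
Qed.

(* Square root of the weight that writes |x|^{-2b} as a superposition of *)
(* products of two Gaussians.                                             *)
Definition gauss_weight (b s : R) : R :=
  ((4 / pi) `^ h / Gamma b * powR_density (b + h) s) `^ (2^-1).

Definition gauss_kernel (b : R) (x : Rn) (w : T * Rn) : R :=
  gauss_weight b w.1 * expR (- (2 * w.1 * sqdist x w.2)).

Lemma gauss_weight_ge0 b s : 0 <= gauss_weight b s.
Proof. exact: powR_ge0. Qed.

Lemma gauss_kernel_ge0 b x w : 0 <= gauss_kernel b x w.
Proof. by rewrite mulr_ge0 ?expR_ge0 ?gauss_weight_ge0. Qed.

Lemma gauss_weight_gt0 (b s : R) : 0 < b -> 0 < s -> 0 < gauss_weight b s.
Proof.
move=> b0 s0; rewrite powR_gt0// mulr_gt0//.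
  by rewrite divr_gt0 ?Gamma_gt0// powR_gt0 ?divr_gt0 ?pi_gt0.
by rewrite powR_densityE// powR_gt0.
Qed.

Lemma measurable_gauss_kernel (b : R) :
  measurable_fun setT (fun p : Rn * (T * Rn) => gauss_kernel b p.1 p.2).
Proof.
apply: measurable_funM.
  apply: (measurableT_comp (measurable_powR _)); apply: measurable_funM => //.
  apply: (measurableT_comp (measurable_powR_density _)).
  exact: measurableT_comp.
do 2 apply: measurableT_comp => //; apply: measurable_funM.
  by apply: measurable_funM => //; exact: measurableT_comp.
by apply: measurable_sqdist => //; exact: measurableT_comp.
Qed.

(** Two Gaussians of parameter 2s compose to exp(-s|x-y|^2) times (pi/(4s))^h. The squared weight
    contains (4s/pi)^h to cancel this factor, which explains the exponent b + h, and what is left is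
    the Gamma representation of |x-y|^(-2b). *)
Lemma gauss_kernel_composition (b : R) (x y : Rn) : 0 < b -> x <> y ->
  ((riesz_kernel b x y)%:E =
   \int[lebesgue_measure]_s \int[mu]_z
     (gauss_kernel b x (s, z) * gauss_kernel b y (s, z))%:E)%E.
Proof.
move=> b0 xy; have Gb := Gamma_gt0 b0.
transitivity ((Gamma b)^-1%:E * (riesz_kernel b x y * Gamma b)%:E)%E.
  by rewrite -EFinM mulrC mulfK// gt_eqF.
rewrite riesz_kernel_gamma// -ge0_integralZl//; last 3 first.
- apply/measurable_EFinP/measurable_funM; first exact: measurable_powR_density.
  by do 2 apply: measurableT_comp => //; exact: measurable_funM.
- by move=> s _; rewrite lee_fin mulr_ge0 ?powR_density_ge0 ?expR_ge0.
- by rewrite lee_fin invr_ge0 ltW.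
apply: eq_integral => s _.
have [s0|s0] := leP s 0.
  rewrite powR_density0// mul0r mule0 integral0_eq// => z _.
  rewrite /gauss_kernel/= /gauss_weight powR_density0// mulr0 powR0 ?invr_eq0//.
  by rewrite !mul0r.
transitivity (\int[mu]_z ((gauss_weight b s ^+ 2)%:E *
    (expR (- (2 * s * sqdist x z + 2 * s * sqdist y z)))%:E))%E; last first.
  apply: eq_integral => z _; rewrite -EFinM /gauss_kernel/= opprD expRD.
  by congr EFin; ring.
rewrite ge0_integralZl//; last 2 first.
- exact: measurable_gauss2.
- by rewrite lee_fin exprn_ge0// gauss_weight_ge0.
rewrite integral_gauss_prod ?mulr_gt0// sqrt_powR_half; last first.
  by rewrite divr_ge0 ?pi_ge0// addr_ge0// mulr_ge0// ltW.
rewrite /gauss_weight -powR_mulrn ?powR_ge0// -powRrM mulVf// powRr1; last first.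
  apply: mulr_ge0; last exact: powR_density_ge0.
  by apply: divr_ge0; [exact: powR_ge0|exact: ltW].
rewrite -powR_densityM -!EFinM.
have -> : 2 * s + 2 * s = 4 * s by ring.
have sn0 : s != 0 by rewrite gt_eqF.
have -> : 2 * s * (2 * s) / (4 * s) = s by field.
have pi0 := pi_gt0 R.
have Hh : (4 / pi) `^ h * s `^ h * (pi / (4 * s)) `^ h = 1.
  have pin0 : (pi : R) != 0 by rewrite gt_eqF.
  have q1 : 0 <= 4 / pi :> R by rewrite divr_ge0 ?pi_ge0.
  have q2 : 0 <= pi / (4 * s) by rewrite divr_ge0 ?pi_ge0// mulr_ge0// ltW.
  have q3 : 0 <= 4 / pi * s by rewrite mulr_ge0// ltW.
  rewrite -(powRM h q1 (ltW s0)) -(powRM h q3 q2).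
  have F3 (v w : R) : v != 0 -> w != 0 -> 4 / v * w * (v / (4 * w)) = 1.
    by move=> v0 w0; field; rewrite v0 w0.
  by rewrite F3// powR1.
congr EFin.
transitivity ((Gamma b)^-1 * (powR_density b s * expR (- (s * sqdist x y))) *
   ((4 / pi) `^ h * s `^ h * (pi / (4 * s)) `^ h)).
  by rewrite Hh mulr1.
by move: (Gamma _)^-1 => A; ring.
Qed.

End riesz_kernel.

(** * Injectivity of the Riesz form *)

Section density_measure.
Context d (T : measurableType d) (R : realType).
Variable mu : {measure set T -> \bar R}.
Variables (f : T -> \bar R) (mf : measurable_fun setT f) (f0 : forall x, (0 <= f x)%E).

(* The proof arguments only serve to key the measure instance on m. *)
Definition density_measure (_ : measurable_fun setT f) (_ : forall x, (0 <= f x)%E)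
  (A : set T) : \bar R := (\int[mu]_(x in A) f x)%E.

Local Notation m := (density_measure mf f0).

Let m0 : m set0 = 0%E.
Proof. exact: integral_set0. Qed.

Let m_ge0 A : (0 <= m A)%E.
Proof. exact: integral_ge0. Qed.

Let m_sigma_additive : semi_sigma_additive m.
Proof.
move=> /= A mA tA mUA; rewrite /m ge0_integral_bigcup//=; last exact: measurable_funTS.
by apply: is_cvg_ereal_nneg_natsum_cond => n _ _; exact: integral_ge0.
Qed.

HB.instance Definition _ := isMeasure.Build _ _ _ m m0 m_ge0 m_sigma_additive.

End density_measure.

Lemma ge0_integral_eq0_ae d (T : measurableType d) (R : realType)
    (mu : {measure set T -> \bar R}) (f : T -> \bar R) :
  measurable_fun setT f -> (forall x, 0 <= f x)%E ->
  (\int[mu]_x f x = 0)%E -> {ae mu, forall x, f x = 0%E}.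
Proof.
move=> mf f0 f_0; have [H _] := ae_eq_integral_abs mu measurableT mf.
have : ae_eq mu setT f (cst 0%E).
  by apply: H; rewrite -[RHS]f_0; apply: eq_integral => x _; rewrite gee0_abs.
by apply: filterS => x /= ->.
Qed.

(** * Boxes: generation of the sigma-algebra, uniqueness, distance to the boundary *)

Section boxes.
Variables (R : realType) (n : nat).
Local Notation T := (measurableTypeR R).
Local Notation Rn := (n.-tuple T).
Local Notation mu := (@lebesgue_Rd R n).
Implicit Types (a b : 'I_n -> R).

Definition box a b : set Rn := [set x | forall i, tnth x i \in `]a i, b i]%R].

Lemma box_bigcap a b : box a b =
  \bigcap_(i in setT) ((@tnth n T ^~ i) @^-1` `]a i, b i]%classic).
Proof.
apply/seteqP; split=> x /= H i; first by move=> _; exact: H.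
exact: (H i I).
Qed.

Lemma measurable_box a b : measurable (box a b).
Proof.
rewrite box_bigcap; apply: fin_bigcap_measurable => // i _.
by rewrite -[X in measurable X]setTI; exact: measurable_tnth.
Qed.

Lemma box_setI a b a' b' : box a b `&` box a' b' =
  box (fun i => Num.max (a i) (a' i)) (fun i => Num.min (b i) (b' i)).
Proof.
apply/seteqP; split=> x /=.
  move=> [H H'] i; move: (H i) (H' i); rewrite !in_itv/=.
  by rewrite gt_max le_min => /andP[-> ->] /andP[-> ->].
move=> H; split=> i; move: (H i); rewrite !in_itv/= gt_max le_min;
  by case/andP => /andP[? ?] /andP[? ?]; apply/andP; split.
Qed.

Let cube (k : nat) : set Rn := box (fun=> - k%:R) (fun=> k%:R).

Lemma bounded_in_cube (x : Rn) : exists k0 : nat, forall k : nat, (k0 <= k)%N -> cube k x.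
Proof.
pose M : R := \sum_(i < n) `|tnth x i : R|.
have M0 : 0 <= M by apply: sumr_ge0.
exists (Num.truncn M).+1 => k kk i; rewrite in_itv/=.
have Mk : M < k%:R by apply: lt_le_trans (Num.Theory.truncnS_gt _) _; rewrite ler_nat.
have xM : `|tnth x i : R| <= M.
  by rewrite /M (bigD1 i)//= lerDl sumr_ge0.
have := le_lt_trans xM Mk; rewrite ltr_norml => /andP[-> /ltW ->//].
Qed.

(** The coordinate preimage of an interval ]u, v] is the increasing union of the boxes with that
    side and all other sides ]-k, k]. *)
Lemma box_generates : @measurable _ Rn = <<s [set A | exists a b, A = box a b] >>.
Proof.
set G := [set A | _].
apply/seteqP; split; last first.
  apply: smallest_sub; first exact: sigma_algebra_measurable.
  by move=> A [a [b ->]]; exact: measurable_box.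
apply: smallest_sub; first exact: smallest_sigma_algebra.
rewrite -bigcup_seq/= => A [i _ [Y mY <-]]; rewrite setTI.
pose H := [set Y : set T | <<s G >> ((@tnth n T ^~ i) @^-1` Y)].
suff : <<s @ocitv R >> `<=` H by apply.
apply: smallest_sub.
  split => /=.
  - rewrite /H/= preimage_set0; exact: sigma_algebra0.
  - move=> B HB; rewrite /H/= setTD preimage_setC.
    by apply: sigma_algebraC.
  - move=> B HB; rewrite /H/= preimage_bigcup; exact: sigma_algebra_bigcup.
move=> _ [[u v] _ <-]; rewrite /H /=.
have -> : (@tnth n T ^~ i) @^-1` `]u, v]%classic =
    \bigcup_k box (fun j => if j == i then u else - k%:R)
                  (fun j => if j == i then v else k%:R).
  apply/seteqP; split=> x /=.
    move=> xuv; have [k0 Hk] := bounded_in_cube x.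
    exists k0 => //= j; case: eqP => [->//|_].
    exact: (Hk k0 (leqnn _) j).
  by move=> [k _ /(_ i)]; rewrite eqxx.
apply: sigma_algebra_bigcup => k; apply: sub_sigma_algebra.
by rewrite /G/=; eexists; eexists.
Qed.

(** The measures with densities f^+ and f^- agree on boxes, which are stable under intersection,
    hence on all measurable sets. On the set where f > 0 the second measure vanishes and the first
    has its full mass, and conversely on the complement; so both are zero. *)
Lemma box_integral0_ae (f : Rn -> R) : measurable_fun setT f ->
  (forall a b, mu.-integrable (box a b) (EFin \o f)) ->
  (forall a b, \int[mu]_(x in box a b) (f x)%:E = 0)%E ->
  {ae mu, forall x, f x = 0}.
Proof.
move=> mf fi f0.
have mf' : measurable_fun setT (EFin \o f) by exact/measurable_EFinP.
have mp := measurable_funepos mf'; have mn := measurable_funeneg mf'.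
pose m1 := density_measure mu mp (funepos_ge0 _).
pose m2 := density_measure mu mn (funeneg_ge0 _).
have m12 A : measurable A -> m1 A = m2 A.
  apply: (measure_unique [set A | exists a b, A = box a b] cube).
  - exact: box_generates.
  - move=> _ _ [a [b ->]] [a' [b' ->]]; rewrite box_setI.
    by eexists; eexists.
  - by move=> k; eexists; eexists.
  - apply/seteqP; split => // x _; have [k0 H] := bounded_in_cube x.
    by exists k0 => //; exact: H.
  - move=> _ [a [b ->]]; have := f0 a b.
    rewrite integralE /m1 /m2 /density_measure.
    have Fp := integrable_pos_fin_num (measurable_box a b) (fi a b).
    have Fn := integrable_neg_fin_num (measurable_box a b) (fi a b).
    by move/eqP; rewrite sube_eq ?add0e ?fin_num_adde_defl// => /eqP.
  - move=> k; have := integrable_pos_fin_num (measurable_box _ _) (fi (fun=> - k%:R) (fun=> k%:R)).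
    by rewrite ge0_fin_numE// integral_ge0.
pose P : set Rn := [set x | 0 < f x].
have mP : measurable P.
  have -> : P = f @^-1` `]0, +oo[%classic.
    by apply/seteqP; split => x /=; rewrite in_itv/= andbT.
  by rewrite -[X in measurable X]setTI; exact: mf.
have pos0 : (\int[mu]_x (EFin \o f)^\+ x = 0)%E.
  transitivity (m1 P).
    rewrite /m1 /density_measure integral_mkcond; apply: eq_integral => x _.
    rewrite patchE; case: ifPn => //; rewrite notin_setE => /negP; rewrite -leNgt => fx.
    by rewrite funeposE/= max_r// lee_fin.
  rewrite m12// /m2 /density_measure integral0_eq// => x fx.
  by rewrite funenegE/= max_r// lee_fin oppr_le0 ltW.
have neg0 : (\int[mu]_x (EFin \o f)^\- x = 0)%E.
  transitivity (m2 (~` P)).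
    rewrite /m2 /density_measure integral_mkcond; apply: eq_integral => x _.
    rewrite patchE; case: ifPn => //; rewrite notin_setE /= => /contrapT fx.
    by rewrite funenegE/= max_r// lee_fin oppr_le0 ltW.
  rewrite -m12; last exact: measurableC.
  rewrite /m1 /density_measure integral0_eq// => x /negP; rewrite -leNgt => fx.
  by rewrite funeposE/= max_r// lee_fin.
have := ge0_integral_eq0_ae mp (funepos_ge0 _) pos0.
have := ge0_integral_eq0_ae mn (funeneg_ge0 _) neg0.
apply: filterS2 => x nx px; apply: EFin_inj.
apply/eqP; rewrite eq_le; apply/andP; split.
  by rewrite -[leRHS]px funeposE le_max lexx.
have : (- (f x)%:E <= (EFin \o f)^\- x)%E by rewrite funenegE le_max lexx.
by rewrite nx -EFinN !lee_fin oppr_le0.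
Qed.

Lemma box_boundary_null a b :
  {ae mu, forall x, forall i, tnth x i <> a i /\ tnth x i <> b i}.
Proof.
pose S (i : 'I_n) (c : R) : set Rn := [set x | tnth x i = c].
have S0 (i : 'I_n) (c : R) : mu.-negligible (S i c).
  exists (S i c); split => //; first exact: measurable_hyperplane.
  exact: lebesgue_Rd_hyperplane.
have aeS (i : 'I_n) (c : R) : {ae mu, forall x, tnth x i <> c}.
  by apply: negligibleS (S0 i c) => x /= /contrapT.
have FF := ae_filter_ringOfSetsType mu.
apply: filter_forall => i.
exact: (@filterI _ _ FF _ _ (aeS i (a i)) (aeS i (b i))).
Qed.

Lemma sqdist_coord (x y : Rn) i : (tnth x i - tnth y i : R) ^+ 2 <= sqdist x y.
Proof.
by rewrite /sqdist (bigD1 i)//= lerDl sumr_ge0// => j _; exact: sqr_ge0.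
Qed.

(** A point off the bounding hyperplanes is at positive distance from whichever of the box and its
    complement does not contain it. This gap drives the pointwise convergence of smoothed
    indicators. *)
Lemma box_separated a b (x : Rn) :
  (forall i, tnth x i <> a i /\ tnth x i <> b i) ->
  exists2 e : R, 0 < e &
    (box a b x /\ forall z, ~ box a b z -> e <= sqdist x z) \/
    (~ box a b x /\ forall z, box a b z -> e <= sqdist x z).
Proof.
move=> xab; have [xQ|xQ] := pselect (box a b x).
  (* The 1 only seeds the minimum of the squared distances to the faces. *)
  pose e : R := \big[Num.min/1]_(i < n)
    Num.min ((tnth x i - a i) ^+ 2) ((b i - tnth x i) ^+ 2).
  exists e.
    rewrite /e; apply: lt_bigmin => // i _.
    have [xa xb] := xab i; rewrite lt_min; apply/andP;
      split; rewrite exprn_even_gt0//= subr_eq0; apply/eqP => //.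
    by move/esym.
  left; split => // z zQ.
  have [i zi] : exists i, tnth z i \notin `]a i, b i]%R.
    by apply: contrapT => /forallNP H; apply: zQ => i; apply: contrapT => /negP; exact: H.
  apply: le_trans (sqdist_coord x z i).
  have ei : e <= Num.min ((tnth x i - a i) ^+ 2) ((b i - tnth x i) ^+ 2).
    exact: bigmin_le_cond.
  apply: le_trans ei _.
  move: (xQ i) zi; rewrite !in_itv/= negb_and -leNgt -ltNge => /andP[ax xb].
  move=> /orP[za|bz]; rewrite ge_min; apply/orP; [left|right].
    by rewrite ler_sqr ?nnegrE; lra.
  by rewrite -(sqrrN (_ - tnth z i)) opprB ler_sqr ?nnegrE; lra.
have [i xi] : exists i, tnth x i \notin `]a i, b i]%R.
  by apply: contrapT => /forallNP H; apply: xQ => i; apply: contrapT => /negP; exact: H.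
move: xi; rewrite in_itv/= negb_and -leNgt -ltNge => /orP[xa|bx].
  have [xa' _] := xab i.
  exists ((a i - tnth x i) ^+ 2).
    by rewrite exprn_even_gt0//= subr_eq0; apply/eqP => /esym.
  right; split => // z /(_ i); rewrite in_itv/= => /andP[az _].
  apply: le_trans (sqdist_coord x z i).
  by rewrite -(sqrrN (_ - tnth z i)) opprB ler_sqr ?nnegrE; lra.
have [_ xb'] := xab i.
exists ((tnth x i - b i) ^+ 2).
  by rewrite exprn_even_gt0//= subr_eq0; apply/eqP.
right; split => // z /(_ i); rewrite in_itv/= => /andP[_ zb].
apply: le_trans (sqdist_coord x z i).
by rewrite ler_sqr ?nnegrE; lra.
Qed.

Lemma box_bounded a b (y : Rn) :
  exists M : R, forall z, box a b z -> sqdist z y <= M.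
Proof.
exists (\sum_(i < n) (`|a i| + `|b i| + `|tnth y i : R|) ^+ 2) => z zQ.
apply: ler_sum => i _; rewrite -(@ger0_norm _ (_ ^+ 2)) ?sqr_ge0// normrX.
rewrite ler_sqr ?nnegrE ?addr_ge0//.
apply: le_trans (ler_normB _ _) _; rewrite lerD2r.
have := zQ i; rewrite in_itv/= => /andP[az zb].
rewrite ler_norml; apply/andP; split.
  have := ler_norm (- a i); rewrite normrN; have := normr_ge0 (b i); lra.
have := ler_norm (b i); have := normr_ge0 (a i); lra.
Qed.

End boxes.

(** * Gaussian smoothing of indicators and injectivity of the Gaussian transform *)

Section gauss_injectivity.
Variables (R : realType) (n : nat).
Local Notation T := (measurableTypeR R).
Local Notation Rn := (n.-tuple T).
Local Notation mu := (@lebesgue_Rd R n).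

(** A Gaussian probability density in z centred at x; [s + s] matches [integral_gauss_prod] with two
    equal parameters. *)
Definition gauss_density (s : R) (x z : Rn) : R :=
  (Num.sqrt (pi / (s + s)) ^+ n)^-1 * expR (- (2 * s * sqdist x z)).

Lemma gauss_density_ge0 s x z : 0 <= gauss_density s x z.
Proof. by rewrite mulr_ge0 ?expR_ge0// invr_ge0 exprn_ge0. Qed.

Let peak0 (s : R) : 0 < s -> 0 < Num.sqrt (pi / (s + s)) ^+ n.
Proof. by move=> s0; rewrite exprn_gt0// sqrtr_gt0 divr_gt0 ?pi_gt0// addr_gt0. Qed.

Lemma measurable_gauss_density s d0 (S : measurableType d0) (f g : S -> Rn) :
  measurable_fun setT f -> measurable_fun setT g ->
  measurable_fun setT (fun w => gauss_density s (f w) (g w)).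
Proof.
move=> mf mg; apply: measurable_funM => //; do 2 apply: measurableT_comp => //.
by apply: measurable_funM => //; exact: measurable_sqdist.
Qed.

Let mgd s x : measurable_fun setT (fun z => (gauss_density s x z)%:E).
Proof. by apply/measurable_EFinP; exact: measurable_gauss_density. Qed.

Lemma integral_gauss_density (s : R) (x : Rn) : 0 < s ->
  (\int[mu]_z (gauss_density s x z)%:E = 1)%E.
Proof.
move=> s0.
transitivity (\int[mu]_z (((Num.sqrt (pi / (s + s)) ^+ n)^-1)%:E *
    (expR (- (s * sqdist x z + s * sqdist x z)))%:E))%E.
  apply: eq_integral => z _; rewrite -EFinM /gauss_density.
  by congr (_ * expR _)%:E; ring.
rewrite ge0_integralZl//; last exact: measurable_gauss2.
rewrite integral_gauss_prod// -EFinM.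
have -> : sqdist x x = 0 by apply/eqP; rewrite sqdist_eq0.
by rewrite mulr0 oppr0 expR0 mulr1 mulVf// gt_eqF// peak0.
Qed.

(** The indicator of Q smoothed at scale s^(-1/2). *)
Definition gauss_mass (s : R) (Q : set Rn) (x : Rn) : R :=
  fine (\int[mu]_(z in Q) (gauss_density s x z)%:E)%E.

Lemma gauss_massE (s : R) Q x : 0 < s -> measurable Q ->
  ((gauss_mass s Q x)%:E = \int[mu]_(z in Q) (gauss_density s x z)%:E)%E.
Proof.
move=> s0 mQ; rewrite fineK// ge0_fin_numE; last first.
  by apply: integral_ge0 => z _; rewrite lee_fin gauss_density_ge0.
apply: (@le_lt_trans _ _ (\int[mu]_z (gauss_density s x z)%:E)%E).
  apply: ge0_subset_integral => // z _; by rewrite lee_fin gauss_density_ge0.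
by rewrite integral_gauss_density// ltry.
Qed.

Lemma gauss_mass_ge0 s Q x : 0 <= gauss_mass s Q x.
Proof.
by apply: fine_ge0; apply: integral_ge0 => z _; rewrite lee_fin gauss_density_ge0.
Qed.

Lemma gauss_massC (s : R) Q x : 0 < s -> measurable Q ->
  gauss_mass s (~` Q) x = 1 - gauss_mass s Q x.
Proof.
move=> s0 mQ; have mQC := measurableC mQ.
have : (gauss_mass s Q x + gauss_mass s (~` Q) x)%:E = 1%:E.
  rewrite EFinD !gauss_massE// -ge0_integral_setU//.
  - by rewrite setUv integral_gauss_density.
  - exact: measurable_funTS.
  - by move=> z _; rewrite lee_fin gauss_density_ge0.
  - by apply/disj_setPS; rewrite setICr.
by move=> /(congr1 fine) /= <-; rewrite addrAC subrr add0r.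
Qed.

(* Half of the Gaussian exponent bounds the tail, the other half stays integrable. *)
Lemma gauss_mass_tail (s t e : R) Q x : 0 < s -> 0 <= t -> t <= s ->
  measurable Q -> (forall z, Q z -> e <= sqdist x z) ->
  gauss_mass s Q x <= Num.sqrt 2 ^+ n * expR (- (t * e)).
Proof.
move=> s0 t0 ts mQ Qe; rewrite -lee_fin gauss_massE//.
have s20 : 0 < s / 2 by rewrite divr_gt0.
pose c := Num.sqrt (pi / (s + s)) ^+ n.
have c0 : 0 < c by exact: peak0.
apply: (@le_trans _ _ (\int[mu]_(z in Q) ((c^-1 * expR (- (t * e)))%:E *
   (expR (- (s / 2 * sqdist x z + s / 2 * sqdist x z)))%:E))%E).
  apply: ge0_le_integral => //.
  - by move=> z _; rewrite lee_fin gauss_density_ge0.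
  - exact: measurable_funTS.
  - apply: measurable_funTS; apply: emeasurable_funM => //.
    exact: measurable_gauss2.
  - move=> z Qz; rewrite -EFinM lee_fin /gauss_density -[leRHS]mulrA -expRD.
    rewrite ler_wpM2l ?invr_ge0 ?(ltW c0)// ler_expR.
    have H1 : t * e <= t * sqdist x z by rewrite ler_wpM2l// Qe.
    have H2 : t * sqdist x z <= s * sqdist x z by rewrite ler_wpM2r ?sqdist_ge0.
    lra.
apply: (@le_trans _ _ (\int[mu]_z ((c^-1 * expR (- (t * e)))%:E *
   (expR (- (s / 2 * sqdist x z + s / 2 * sqdist x z)))%:E))%E).
  apply: ge0_subset_integral => //.
    by apply: emeasurable_funM => //; exact: measurable_gauss2.
  by move=> z _; rewrite mule_ge0// lee_fin mulr_ge0 ?expR_ge0// invr_ge0 ltW.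
rewrite ge0_integralZl//; last 2 first.
- exact: measurable_gauss2.
- by rewrite lee_fin mulr_ge0 ?invr_ge0 ?expR_ge0 ?ltW.
rewrite integral_gauss_prod// -EFinM lee_fin.
have -> : sqdist x x = 0 by apply/eqP; rewrite sqdist_eq0.
rewrite mulr0 oppr0 expR0 mulr1 mulrAC ler_wpM2r ?expR_ge0//.
(* Halving the exponent doubles the variance, whence the factor [Num.sqrt 2 ^+ n]. *)
have -> : pi / (s / 2 + s / 2) = 2 * (pi / (s + s)) by field; rewrite gt_eqF ?addr_gt0.
by rewrite sqrtrM// exprMn mulrC mulfK// gt_eqF.
Qed.

(** The bound is uniform in s >= 4 s0 and serves as majorant for s -> infinity. It is the tail bound
    with t = 4 s0 and e = |x-z0|^2/2 - M, a lower bound of |x-z|^2 on Q because |x-z0|^2 <= 2|x-z|^2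
    + 2|z-z0|^2. *)
Lemma gauss_mass_dominated (s s0 M : R) Q (x z0 : Rn) : 0 < s0 -> 4 * s0 <= s ->
  measurable Q -> (forall z, Q z -> sqdist z z0 <= M) ->
  gauss_mass s Q x <=
    Num.sqrt 2 ^+ n * expR (4 * s0 * M) * expR (- (2 * s0 * sqdist x z0)).
Proof.
move=> s00 s0s mQ QM; have s40 : 0 < 4 * s0 by rewrite mulr_gt0.
rewrite -mulrA -expRD.
have -> : 4 * s0 * M - 2 * s0 * sqdist x z0 = - (4 * s0 * (sqdist x z0 / 2 - M)) by lra.
apply: gauss_mass_tail => //; first exact: lt_le_trans s0s.
  exact: ltW.
move=> z /QM zM; rewrite lerBlDr ler_pdivrMr//.
suff : sqdist x z0 <= 2 * sqdist x z + 2 * sqdist z z0 by lra.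
rewrite /sqdist !mulr_sumr -big_split/=; apply: ler_sum => i _.
set u : R := tnth x i; set v : R := tnth z i; set w : R := tnth z0 i.
by have := sqr_ge0 ((u - v) - (v - w)); nra.
Qed.

Lemma measurable_gauss_mass s Q : measurable Q ->
  measurable_fun setT (gauss_mass s Q).
Proof.
move=> mQ; apply: (measurableT_comp (f := fine)); first exact: fine_measurable.
rewrite (_ : (fun x => _) = (fun x => \int[mu]_z
    ((gauss_density s x z)%:E * (\1_Q z)%:E))%E).
  apply: (@measurable_fun_fubini_tonelli_F _ _ _ _ _ _
    (fun p : Rn * Rn => (gauss_density s p.1 p.2)%:E * (\1_Q p.2)%:E)%E) => [|p].
    apply: emeasurable_funM; first by apply/measurable_EFinP; exact: measurable_gauss_density.
    by apply/measurable_EFinP; apply: measurableT_comp.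
  by rewrite -EFinM lee_fin mulr_ge0 ?gauss_density_ge0.
apply/funext => x; rewrite integral_mkcond; apply: eq_integral => z _.
by rewrite patchE indicE; case: ifPn => _; rewrite ?mule1 ?mule0.
Qed.

(** By [box_separated] the error is a Gaussian tail: the mass of the complement if x is in the box,
    the mass of the box otherwise. *)
Lemma gauss_mass_indic (a b : 'I_n -> R) (x : Rn) :
  (forall i, tnth x i <> a i /\ tnth x i <> b i) ->
  exists2 e : R, 0 < e & forall s : R, 0 < s ->
    `|gauss_mass s (box a b) x - \1_(box a b) x| <=
      Num.sqrt 2 ^+ n * expR (- (s * e)).
Proof.
move=> /box_separated[e e0 H]; exists e => // s s0.
have mQ := measurable_box a b.
case: H => [[xQ He]|[xQ He]]; rewrite indicE.
  rewrite mem_set// mulr1n distrC -gauss_massC// ger0_norm ?gauss_mass_ge0//.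
  apply: gauss_mass_tail => //; first exact: ltW.
  exact: measurableC.
rewrite memNset// mulr0n subr0 ger0_norm ?gauss_mass_ge0//.
by apply: gauss_mass_tail => //; exact: ltW.
Qed.

(** * Recovering f from vanishing Gaussian transforms along widths tending to zero *)

Section inversion.
Variables (f : Rn -> R) (s_ : nat -> R) (s0 : R) (z0 : Rn).
Hypothesis mf : measurable_fun setT f.
Hypothesis s00 : 0 < s0.
Hypothesis s_lt : forall k, k%:R < s_ k.
Hypothesis f_decay :
  (\int[mu]_x (`|f x| * expR (- (2 * s0 * sqdist x z0)))%:E < +oo)%E.
Hypothesis f_gauss0 : forall k,
  {ae mu, forall z, (\int[mu]_x (f x * gauss_density (s_ k) x z))%R = 0}.

Let s_gt0 k : 0 < s_ k.
Proof. exact: le_lt_trans (s_lt k). Qed.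

Let majorant (C : R) (x : Rn) : \bar R :=
  (C * (`|f x| * expR (- (2 * s0 * sqdist x z0))))%:E.

Let integrable_majorant (C : R) : mu.-integrable setT (majorant C).
Proof.
suff H : mu.-integrable setT (fun x => (`|f x| * expR (- (2 * s0 * sqdist x z0)))%:E).
  have := integrableZl measurableT C H.
  by apply: eq_integrable => // x _; rewrite /majorant EFinM.
apply/integrableP; split.
  apply/measurable_EFinP/measurable_funM; first exact: measurableT_comp.
  do 2 apply: measurableT_comp => //; apply: measurable_funM => //.
  exact: measurable_sqdist.
apply: le_lt_trans f_decay; rewrite le_eqVlt; apply/orP; left; apply/eqP.
by apply: eq_integral => x _; rewrite gee0_abs// lee_fin mulr_ge0 ?expR_ge0.
Qed.

Let integrable_box a b : mu.-integrable (box a b) (EFin \o f).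
Proof.
have [M QM] := box_bounded a b z0.
have mQ := measurable_box a b.
have := integrable_majorant (expR (2 * s0 * M)).
move/(integrableS measurableT mQ (@subsetT _ _)); apply: le_integrable => //.
  by apply: measurable_funTS; exact/measurable_EFinP.
move=> x Qx; rewrite /majorant /= lee_fin (@ger0_norm _ (_ * _)); last first.
  by rewrite mulr_ge0 ?expR_ge0// mulr_ge0 ?expR_ge0.
rewrite mulrCA -expRD ler_peMr// -[leLHS]expR0 ler_expR.
have := ler_wpM2l (ltW s00) (QM x Qx); lra.
Qed.

(** Integrate the vanishing transforms over z in the box and exchange the integrals;
    [4 * s0 <= s_ k] provides the majorant for Fubini. *)
Let integral_mass0 (a b : 'I_n -> R) (k : nat) : 4 * s0 <= s_ k ->
  (\int[mu]_x (f x * gauss_mass (s_ k) (box a b) x)%:E = 0)%E.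
Proof.
move=> sk; have [M QM] := box_bounded a b z0.
have mQ := measurable_box a b.
pose P (p : Rn * Rn) := (f p.1 * gauss_density (s_ k) p.1 p.2 * \1_(box a b) p.2)%:E.
have mI : measurable_fun setT (fun p : Rn * Rn => \1_(box a b) p.2 : R).
  by apply: measurableT_comp.
have mP : measurable_fun setT P.
  apply/measurable_EFinP; apply: measurable_funM => //.
  apply: measurable_funM; first exact: measurableT_comp.
  exact: measurable_gauss_density.
have massE x : (\int[mu]_z (gauss_density (s_ k) x z * \1_(box a b) z)%:E =
    (gauss_mass (s_ k) (box a b) x)%:E)%E.
  rewrite gauss_massE// [RHS]integral_mkcond; apply: eq_integral => z _.
  by rewrite patchE indicE; case: ifPn => _; rewrite ?mulr1 ?mulr0.
have mgi x : measurable_fun setT (fun z => (gauss_density (s_ k) x z * \1_(box a b) z)%:E).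
  by apply/measurable_EFinP; apply: measurable_funM => //; exact: measurable_gauss_density.
have gi0 x z : (0 <= (gauss_density (s_ k) x z * \1_(box a b) z)%:E)%E.
  by rewrite lee_fin mulr_ge0 ?gauss_density_ge0.
have iP : (mu \x mu)%E.-integrable setT P.
  apply/integrable12ltyP => //.
  pose C : R := Num.sqrt 2 ^+ n * expR (4 * s0 * M).
  have /integrableP[_] := integrable_majorant C; apply: le_lt_trans.
  apply: ge0_le_integral => //.
  - by move=> x _; exact: integral_ge0.
  - apply: (@measurable_fun_fubini_tonelli_F _ _ _ _ _ _ (abse \o P)) => [|p].
      exact: measurableT_comp.
    exact: abse_ge0.
  - by apply: measurableT_comp => //; exact: (measurable_int mu (integrable_majorant C)).
  - move=> x _; rewrite (eq_integral (fun z =>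
      `|f x|%:E * (gauss_density (s_ k) x z * \1_(box a b) z)%:E)%E); last first.
      move=> z _; rewrite /P /= -EFinM -mulrA normrM (@ger0_norm _ (_ * _))//.
      by rewrite mulr_ge0 ?gauss_density_ge0.
    rewrite ge0_integralZl// massE -EFinM /majorant /= lee_fin.
    rewrite (@ger0_norm _ (C * _)); last first.
      by rewrite !mulr_ge0 ?expR_ge0// exprn_ge0.
    rewrite mulrCA ler_wpM2l//; exact: gauss_mass_dominated.
transitivity (\int[mu]_x \int[mu]_z P (x, z))%E.
  apply: eq_integral => x _; rewrite /P /=.
  under [RHS]eq_integral do rewrite -mulrA EFinM.
  rewrite integralZl// ?massE//.
  apply/integrableP; split => //.
  rewrite (eq_integral (fun z => (gauss_density (s_ k) x z * \1_(box a b) z)%:E)).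
    by rewrite massE ltry.
  by move=> z _; rewrite gee0_abs.
rewrite (Fubini iP) -[RHS](integral0 mu setT).
apply: ae_eq_integral => //.
  exact: (measurable_fubini_G iP).
have FF := ae_filter_ringOfSetsType mu.
apply: (@filterS2 _ _ FF _ _ _ _ (f_gauss0 k) (ae_integrable2 iP)) => z fz iz _.
by rewrite /P /= in iz *; rewrite (integral_scale_Rintegral iz) fz mul0r.
Qed.

(** Let the parameter tend to infinity in [integral_mass0]: the smoothed indicators converge to the
    indicator off the bounding hyperplanes, under a common majorant. *)
Let integral_box0 a b : (\int[mu]_(x in box a b) (f x)%:E = 0)%E.
Proof.
have [M QM] := box_bounded a b z0.
have mQ := measurable_box a b.
(* Shifting the sequence by [K0] puts every parameter above [4 * s0], as [s_ k] exceeds k. *)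
pose K0 := (Num.truncn (4 * s0)).+1.
have sK k : 4 * s0 <= s_ (k + K0)%N.
  apply/ltW/(lt_trans _ (s_lt _)).
  apply: (lt_le_trans (Num.Theory.truncnS_gt _)).
  by rewrite ler_nat leq_addl.
pose C : R := Num.sqrt 2 ^+ n * expR (4 * s0 * M).
have [] := @dominated_convergence _ _ _ mu setT measurableT
  (fun k x => (f x * gauss_mass (s_ (k + K0)%N) (box a b) x)%:E)
  (fun x => (f x * \1_(box a b) x)%:E) (majorant C).
- move=> k; apply/measurable_EFinP; apply: measurable_funM => //.
  exact: measurable_gauss_mass.
- by apply/measurable_EFinP; apply: measurable_funM.
- have FF := ae_filter_ringOfSetsType mu.
  apply: (@filterS _ _ FF _ _ _ (box_boundary_null a b)) => x /gauss_mass_indic[e e0 He] _.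
  apply: cvg_EFin; first exact: nearW.
  apply: cvgM; first exact: cvg_cst.
  apply/cvgrPdist_le => d d0; pose c : R := Num.sqrt 2 ^+ n.
  (* Since exp(s e) >= s e, the error c exp(-s e) is at most d as soon as c <= d e s. *)
  exists (Num.truncn (c / (d * e))).+1 => // k /= Nk.
  have de0 : 0 < d * e by rewrite mulr_gt0.
  rewrite distrC (le_trans (He _ (s_gt0 _)))// -/c expRN ler_pdivrMr ?expR_gt0//.
  set s := s_ (k + K0)%N.
  have ks : c / (d * e) <= s.
    apply/ltW/(lt_trans (Num.Theory.truncnS_gt _))/(le_lt_trans _ (s_lt _)).
    by rewrite ler_nat (leq_trans Nk)// leq_addr.
  have Hs : c <= d * e * s by rewrite -ler_pdivrMl// mulrC.
  apply: (le_trans Hs); rewrite -mulrA ler_wpM2l ?(ltW d0)//.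
  by apply: le_trans (expR_ge1Dx _); rewrite mulrC lerDr.
- exact: integrable_majorant.
- apply: aeW => x k _ /=; rewrite /majorant lee_fin normrM.
  rewrite (ger0_norm (gauss_mass_ge0 _ _ _)) [leRHS]mulrCA ler_wpM2l//.
  exact: gauss_mass_dominated.
move=> _ _ /=.
have -> : (fun k => \int[mu]_x (f x * gauss_mass (s_ (k + K0)%N) (box a b) x)%:E)%E
    = cst 0%E.
  by apply/funext => k; rewrite integral_mass0.
move=> /cvg_lim; rewrite lim_cst// => -> //.
rewrite integral_mkcond; apply: eq_integral => x _.
by rewrite patchE indicE; case: ifPn => _; rewrite ?mulr1 ?mulr0.
Qed.

Lemma gauss_transform_inj : {ae mu, forall x, f x = 0}.
Proof. exact: (box_integral0_ae mf integrable_box integral_box0). Qed.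

End inversion.

End gauss_injectivity.

Lemma ae_exists_itv (R : realType) (P : R -> Prop) (a b : R) : a < b ->
  {ae @lebesgue_measure R, forall s, P s} -> exists2 s, a < s < b & P s.
Proof.
move=> ab [N [mN N0 PN]]; apply: contrapT => H.
have : (@lebesgue_measure R `]a, b[%classic <= 0)%E.
  rewrite -N0; apply: le_measure; rewrite ?inE//.
  move=> s/=; rewrite in_itv/= => sab; apply: PN => /= Ps.
  by apply: H; exists s.
by rewrite lebesgue_measure_itv/= lte_fin ab -EFinD lee_fin subr_le0 leNgt ab.
Qed.

Lemma ae_exists_Rd (R : realType) n (P : n.-tuple (measurableTypeR R) -> Prop) :
  {ae lebesgue_Rd n, forall z, P z} -> exists z, P z.
Proof.
move=> [N [mN N0 PN]]; apply: contrapT => H.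
have : (lebesgue_Rd n [set x : n.-tuple (measurableTypeR R) |
    forall i, `]0%R, 1%R]%classic (tnth x i : R)] <= 0)%E.
  rewrite -N0; apply: le_measure; rewrite ?inE//.
    exact: (measurable_box (fun=> 0) (fun=> 1)).
  move=> z _; apply: PN => /= Pz; by apply: H; exists z.
rewrite (@lebesgue_Rd_box R n (fun=> `]0%R, 1%R]%classic))//.
under eq_bigr do rewrite lebesgue_measure_itv/= lte01 oppr0 adde0.
by rewrite big1// leNgt lte01.
Qed.

Lemma ge0_integral_lty_ae d (T : measurableType d) (R : realType)
    (mu : {measure set T -> \bar R}) (f : T -> \bar R) :
  measurable_fun setT f -> (forall x, 0 <= f x)%E ->
  (\int[mu]_x f x < +oo)%E -> {ae mu, forall x, (f x < +oo)%E}.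
Proof.
move=> mf f0 foo.
have fi : mu.-integrable setT f.
  apply/integrableP; split => //; rewrite (eq_integral f)// => x _.
  by rewrite gee0_abs.
have FF := ae_filter_ringOfSetsType mu.
apply: (@filterS _ _ FF _ _ _ (integrable_ae measurableT fi)) => x /(_ I).
by rewrite ge0_fin_numE.
Qed.

(** * A real function with vanishing Riesz form is zero *)

Section riesz_form_injectivity.
Variables (R : realType) (n : nat).
Local Notation T := (measurableTypeR R).
Local Notation Rn := (n.-tuple T).
Local Notation mu := (@lebesgue_Rd R n).
Variables (b : R) (f : Rn -> R).
Hypotheses (n0 : (0 < n)%N) (b0 : 0 < b) (mf : measurable_fun setT f).
Hypothesis foo : (\int[mu]_y \int[mu]_x
  (`|f x| * `|f y| * riesz_kernel b x y)%:E < +oo)%E.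
Hypothesis f_form0 : (\int[mu]_y \int[mu]_x
  (f x * f y * riesz_kernel b x y)%:E = 0)%E.

Local Notation nu := (@lebesgue_Rd R n.+1).

(* The Gaussian parameters (s, z) are packed into one point of R^(n+1). *)
Let k (x : Rn) (w : n.+1.-tuple T) : R := gauss_kernel b x (pair_of_tuple w).

Let mk : measurable_fun setT (fun p : Rn * n.+1.-tuple T => k p.1 p.2).
Proof.
apply: (measurableT_comp (measurable_gauss_kernel b)
  (g := fun p : Rn * n.+1.-tuple T => (p.1, pair_of_tuple p.2))).
apply: measurable_fun_pair => //.
by apply: measurableT_comp => //; exact: measurable_pair_of_tuple.
Qed.

Let mK : measurable_fun setT (fun p : Rn * Rn => riesz_kernel b p.1 p.2).
Proof. exact: measurable_riesz_kernel. Qed.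

Let kkK y : {ae mu, forall x, (riesz_kernel b x y)%:E =
  (\int[nu]_z (k x z * k y z)%:E)%E}.
Proof.
have FF := ae_filter_ringOfSetsType mu.
apply: (@filterS _ _ FF _ _ _ (ae_lebesgue_Rd_neq y n0)) => x xy.
rewrite (gauss_kernel_composition b0 xy) integral_lebesgue_RdS.
- apply: eq_integral => s _; apply: eq_integral => z _.
  by rewrite /k tuple_of_pairK.
- by apply/measurable_EFinP/measurable_funM; exact: (measurable_fun_pair2 _ mk).
- by move=> w; rewrite lee_fin mulr_ge0 ?gauss_kernel_ge0.
Qed.

Local Notation pot := (potential mu k f).
Local Notation epot := (epotential mu k (fun x => `|f x|)).

Let k0 x w : 0 <= k x w.
Proof. exact: gauss_kernel_ge0. Qed.

Let K0 := @riesz_kernel_ge0 R n b.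
Let mfabs : measurable_fun setT (fun x => `|f x|).
Proof. exact: measurableT_comp. Qed.

Let mpot : measurable_fun setT pot.
Proof. exact: measurable_potential. Qed.

Let mepot : measurable_fun setT epot.
Proof. exact: measurable_epotential. Qed.

Let mpot2 : measurable_fun setT (fun w => (pot w * pot w)%:E).
Proof. by apply/measurable_EFinP/measurable_funM. Qed.

Let mepot2 : measurable_fun setT (fun w => epot w * epot w)%E.
Proof. exact: emeasurable_funM. Qed.

Let pot2_ge0 w : (0 <= (pot w * pot w)%:E)%E.
Proof. by rewrite lee_fin -expr2 sqr_ge0. Qed.

Let epot_ge0 w : (0 <= epot w)%E.
Proof. exact: epotential_ge0. Qed.

Let epot2_ge0 w : (0 <= epot w * epot w)%E.
Proof. exact: mule_ge0. Qed.

(** In the Gaussian factorization the squared potential of f has integral 0 and that of |f| has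
    finite integral over R^(n+1); Tonelli passes this to almost every slice at fixed s. *)
Let ae_slices : {ae @lebesgue_measure R, forall s,
  (\int[mu]_z (pot (tuple_of_pair (s, z)) * pot (tuple_of_pair (s, z)))%:E = 0)%E /\
  (\int[mu]_z (epot (tuple_of_pair (s, z)) * epot (tuple_of_pair (s, z))) < +oo)%E}.
Proof.
have FF := ae_filter_ringOfSetsType (@lebesgue_measure R).
apply: (@filterI _ _ FF).
- apply: (@ge0_integral_eq0_ae _ _ _ (@lebesgue_measure R)
    (fun s => \int[mu]_z (pot (tuple_of_pair (s, z)) * pot (tuple_of_pair (s, z)))%:E)%E).
  + exact: (measurable_fun_fubini_tonelli_F
      (fun w : T * Rn => (pot (tuple_of_pair w) * pot (tuple_of_pair w))%:E)
      (measurableT_comp mpot2 (@measurable_tuple_of_pair R n))).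
  + by move=> s; exact: integral_ge0.
  + rewrite -[RHS]f_form0 (kernel_form_potential (k := k) (nu := nu))//.
    by rewrite (integral_lebesgue_RdS mpot2 pot2_ge0).
- apply: (@ge0_integral_lty_ae _ _ _ (@lebesgue_measure R)
    (fun s => \int[mu]_z (epot (tuple_of_pair (s, z)) * epot (tuple_of_pair (s, z))))%E).
  + exact: (measurable_fun_fubini_tonelli_F
      (fun w : T * Rn => epot (tuple_of_pair w) * epot (tuple_of_pair w))%E
      (measurableT_comp mepot2 (@measurable_tuple_of_pair R n))).
  + by move=> s; exact: integral_ge0.
  + move: foo; rewrite (kernel_energyE (k := k) (nu := nu))//.
    by rewrite (integral_lebesgue_RdS mepot2 epot2_ge0).
Qed.

Let slice_pot0 s : (\int[mu]_z (pot (tuple_of_pair (s, z)) * pot (tuple_of_pair (s, z)))%:E = 0)%E ->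
  {ae mu, forall z, pot (tuple_of_pair (s, z)) = 0}.
Proof.
move=> /ge0_integral_eq0_ae; have FF := ae_filter_ringOfSetsType mu.
move=> /(_ (measurable_fun_pair2 s
    (measurableT_comp mpot2 (@measurable_tuple_of_pair R n)))
  (fun z => pot2_ge0 (tuple_of_pair (s, z)))).
apply: (@filterS _ _ FF) => z /eqP; rewrite eqe mulf_eq0 orbb => /eqP.
exact.
Qed.

Let slice_epot s : (\int[mu]_z (epot (tuple_of_pair (s, z)) * epot (tuple_of_pair (s, z))) < +oo)%E ->
  {ae mu, forall z, (epot (tuple_of_pair (s, z)) < +oo)%E}.
Proof.
move=> /ge0_integral_lty_ae; have FF := ae_filter_ringOfSetsType mu.
move=> /(_ (measurable_fun_pair2 s
    (measurableT_comp mepot2 (@measurable_tuple_of_pair R n)))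
  (fun z => epot2_ge0 (tuple_of_pair (s, z)))).
apply: (@filterS _ _ FF) => z; have := epot_ge0 (tuple_of_pair (s, z)).
by move: (epot _) => [r _ _| |//]; rewrite ?ltry// mulyy.
Qed.

(** On good slices the transforms of f vanish for almost every centre. A centre z0 at which the
    potential of |f| is finite for the parameter [s_ 0] supplies the Gaussian decay required by
    [gauss_transform_inj]. *)
Lemma riesz_form_inj : {ae mu, forall x, f x = 0}.
Proof.
have FF := ae_filter_ringOfSetsType mu.
(* Each interval ]j, j+1[ has positive length, so it contains a good parameter; this forces [s_] to
   infinity. *)
have pick (j : nat) : exists s : R, j%:R < s /\
  ({ae mu, forall z, pot (tuple_of_pair (s, z)) = 0} /\
   {ae mu, forall z, (epot (tuple_of_pair (s, z)) < +oo)%E}).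
  have j1 : j%:R < j%:R + 1 :> R by rewrite ltrDl.
  have [s /andP[ks _] [/slice_pot0 H1 /slice_epot H2]] := ae_exists_itv j1 ae_slices.
  by exists s.
have [s_ Hs] := choice pick.
have s_gt0 j : 0 < s_ j by apply: le_lt_trans (Hs j).1.
have [z0 Hz0] := ae_exists_Rd (Hs 0%N).2.2.
have w0 := gauss_weight_gt0 n b0 (s_gt0 0%N).
apply: (@gauss_transform_inj R n f s_ (s_ 0%N) z0) => //.
- by move=> j; exact: (Hs j).1.
- have -> : (\int[mu]_x (`|f x| * expR (- (2 * s_ 0%N * sqdist x z0)))%:E)%E =
     ((gauss_weight n b (s_ 0%N))^-1%:E * epot (tuple_of_pair (s_ 0%N, z0)))%E.
    rewrite /epotential -ge0_integralZl//.
    + apply: eq_integral => x _; rewrite -EFinM /k tuple_of_pairK /gauss_kernel/=.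
      by congr EFin; rewrite mulrCA mulKf// gt_eqF.
    + by apply/measurable_EFinP/measurable_funM => //; exact: (measurable_fun_pair1 _ mk).
    + by move=> x _; rewrite lee_fin mulr_ge0.
    + by rewrite lee_fin invr_ge0 ltW.
  by rewrite lte_mul_pinfty// lee_fin invr_ge0 ltW.
- move=> j; have wk := gauss_weight_gt0 n b0 (s_gt0 j).
  apply: (@filterS2 _ _ FF _ _ _ _ (Hs j).2.1 (Hs j).2.2) => z pz ez.
  have iz : mu.-integrable setT (fun x => (f x * k x (tuple_of_pair (s_ j, z)))%:E).
    apply/integrableP; split.
      by apply/measurable_EFinP/measurable_funM => //; exact: (measurable_fun_pair1 _ mk).
    apply: le_lt_trans ez; rewrite le_eqVlt; apply/orP; left; apply/eqP.
    by apply: eq_integral => x _; rewrite /= normrM (ger0_norm (k0 _ _)).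
  (* The factor from [gauss_kernel] to [gauss_density] at the parameter [s_ j]. *)
  pose c : R := (Num.sqrt (pi / (s_ j + s_ j)) ^+ n)^-1 / gauss_weight n b (s_ j).
  rewrite (@eq_Rintegral _ _ _ mu _ (fun x => f x * k x (tuple_of_pair (s_ j, z)) * c)).
    by rewrite RintegralZr// -/(potential _ _ _ _) pz mul0r.
  move=> x _; rewrite /gauss_density /k tuple_of_pairK /gauss_kernel /c/=.
  by field; rewrite !gt_eqF// exprn_gt0// sqrtr_gt0 divr_gt0 ?pi_gt0// addr_gt0.
Qed.

End riesz_form_injectivity.

(** * The Rollnik norms *)

Lemma normcE (R : rcfType) (z : R[i]) :
  normc z = Num.sqrt (complex.Re z ^+ 2 + complex.Im z ^+ 2).
Proof. by case: z. Qed.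

Lemma sqr_normc (R : rcfType) (z : R[i]) :
  normc z ^+ 2 = complex.Re z ^+ 2 + complex.Im z ^+ 2.
Proof. by rewrite normcE sqr_sqrtr// addr_ge0 ?sqr_ge0. Qed.

Lemma normc_ge0 (R : rcfType) (z : R[i]) : 0 <= normc z.
Proof. by rewrite normcE. Qed.

Lemma normr_Re_le (R : rcfType) (z : R[i]) : `|complex.Re z| <= normc z.
Proof. by rewrite normcE -sqrtr_sqr ler_wsqrtr// lerDl sqr_ge0. Qed.

Lemma normr_Im_le (R : rcfType) (z : R[i]) : `|complex.Im z| <= normc z.
Proof. by rewrite normcE -sqrtr_sqr ler_wsqrtr// lerDr sqr_ge0. Qed.

Lemma normc_real (R : rcfType) (x : R) : 0 <= x -> normc x%:C = x.
Proof. by move=> x0; rewrite normcE/= expr0n addr0 sqrtr_sqr ger0_norm. Qed.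

Lemma measurable_normc d (T : measurableType d) (R : realType) (f : T -> R[i]) :
  measurable_funC f -> measurable_fun setT (fun x => normc (f x)).
Proof.
move=> [mRe mIm].
rewrite (_ : (fun x => _) = (fun x =>
    (complex.Re (f x) ^+ 2 + complex.Im (f x) ^+ 2) `^ 2^-1)).
  apply: (measurableT_comp (measurable_powR _)).
  by apply: measurable_funD; apply: measurable_funX.
by apply/funext => x; rewrite normcE powR12_sqrt// addr_ge0 ?sqr_ge0.
Qed.

(** * Real L^2 norms and Minkowski's inequality *)

Section square_integrable.
Context d (T : measurableType d) (R : realType) (mu : {measure set T -> \bar R}).
Implicit Types u v w : T -> R.

Definition l2 u : R := Num.sqrt (fine (\int[mu]_x (u x ^+ 2)%:E)%E).

Lemma integral_poweR2 u :
  (\int[mu]_x `|(u x)%:E| `^ 2 = \int[mu]_x (u x ^+ 2)%:E)%E.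
Proof.
apply: eq_integral => x _; rewrite /= powR_mulrn ?normr_ge0//.
by rewrite -normrX ger0_norm ?sqr_ge0.
Qed.

Let sqr_integral_ge0 u : (0 <= \int[mu]_x (u x ^+ 2)%:E)%E.
Proof. by apply: integral_ge0 => x _; rewrite lee_fin sqr_ge0. Qed.

Lemma sqr_Lnorm2 u : ('N[mu]_2%:E[EFin \o u] ^+ 2 = \int[mu]_x (u x ^+ 2)%:E)%E.
Proof.
rewrite expe2 unlock /Lnorm integral_poweR2; have := sqr_integral_ge0 u.
move: (integral _ _ _) => [r r0| _|//].
  by rewrite poweR_EFin -EFinM powR12_sqrt ?lee_fin// -expr2 sqr_sqrtr.
by rewrite poweRyr ?gt_eqF// mulyy.
Qed.

Lemma Lnorm2E u : (\int[mu]_x (u x ^+ 2)%:E < +oo)%E ->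
  ('N[mu]_2%:E[EFin \o u] = (l2 u)%:E)%E.
Proof.
move=> uoo; rewrite unlock /Lnorm /l2 integral_poweR2; have := sqr_integral_ge0 u.
move: (integral _ _ _) uoo => [r _ r0| //|//].
by rewrite poweR_EFin powR12_sqrt.
Qed.

Lemma sqr_l2 u : (\int[mu]_x (u x ^+ 2)%:E < +oo)%E ->
  ((l2 u ^+ 2)%:E = \int[mu]_x (u x ^+ 2)%:E)%E.
Proof.
move=> uoo; rewrite /l2 sqr_sqrtr ?fine_ge0// fineK// ge0_fin_numE//.
Qed.

Lemma l2_triangle u v w :
  measurable_fun setT u -> measurable_fun setT v -> measurable_fun setT w ->
  (\int[mu]_x (u x ^+ 2)%:E < +oo)%E ->
  (\int[mu]_x (v x ^+ 2)%:E < +oo)%E -> (\int[mu]_x (w x ^+ 2)%:E < +oo)%E ->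
  {ae mu, forall x, `|u x| <= v x + w x} -> l2 u <= l2 v + l2 w.
Proof.
move=> mu_ mv mw uoo voo woo uvw.
rewrite -lee_fin EFinD -!Lnorm2E//.
have m2 : (1 <= 2 :> R) by rewrite ler1n.
apply: le_trans (minkowski_EFin mu mv mw m2).
have p2 : (0 <= 2^-1 :> R) by rewrite invr_ge0.
rewrite unlock /Lnorm !integral_poweR2.
have I0 f : (\int[mu]_x (f x ^+ 2)%:E)%E \in `[0%E, +oo%E].
  by rewrite in_itv/= leey sqr_integral_ge0.
apply: (gt0_ler_poweR p2); [exact: I0|exact: (I0 (v \+ w))|].
have mvw : measurable_fun setT (v \+ w)%R by exact: measurable_funD.
apply: ae_ge0_le_integral => //.
- by move=> x _; rewrite lee_fin sqr_ge0.
- by apply/measurable_EFinP; exact: measurable_funX.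
- by move=> x _; rewrite lee_fin sqr_ge0.
- by apply/measurable_EFinP; exact: measurable_funX.
have FF := ae_filter_ringOfSetsType mu.
apply: (@filterS _ _ FF _ _ _ uvw) => x ux _; rewrite lee_fin.
rewrite -(@ger0_norm _ (u x ^+ 2)) ?sqr_ge0// normrX ler_sqr ?nnegrE//.
exact: le_trans ux.
Qed.

Lemma l2_ae u v : measurable_fun setT u -> measurable_fun setT v ->
  {ae mu, forall x, u x = v x} -> l2 u = l2 v.
Proof.
move=> mu_ mv uv; congr (Num.sqrt (fine _)); apply: ge0_ae_eq_integral => //.
- by apply/measurable_EFinP; exact: measurable_funX.
- by apply/measurable_EFinP; exact: measurable_funX.
- by move=> x _; rewrite lee_fin sqr_ge0.
- by move=> x _; rewrite lee_fin sqr_ge0.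
have FF := ae_filter_ringOfSetsType mu.
by apply: (@filterS _ _ FF _ _ _ uv) => x ux _; rewrite ux.
Qed.

Lemma integral_sqrZ (a : R) u : measurable_fun setT u ->
  (\int[mu]_x ((a * u x) ^+ 2)%:E = (a ^+ 2)%:E * \int[mu]_x (u x ^+ 2)%:E)%E.
Proof.
move=> mu_; rewrite -ge0_integralZl//.
- by apply: eq_integral => x _; rewrite exprMn EFinM.
- by apply/measurable_EFinP; exact: measurable_funX.
- by move=> x _; rewrite lee_fin sqr_ge0.
- by rewrite lee_fin sqr_ge0.
Qed.

Lemma l2Z (a : R) u : 0 <= a -> measurable_fun setT u ->
  (\int[mu]_x (u x ^+ 2)%:E < +oo)%E -> l2 (fun x => a * u x) = a * l2 u.
Proof.
move=> a0 mu_ uoo; rewrite /l2 (integral_sqrZ a mu_); have := sqr_integral_ge0 u.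
move: (integral _ _ _) uoo => [r _ r0| //|//].
by rewrite -EFinM/= sqrtrM ?sqr_ge0// sqrtr_sqr ger0_norm.
Qed.

(* No integrability is needed: both sides are 0 when the integral is infinite *)
(* or undefined.                                                              *)
Lemma RintegralZl_gt0 (a : R) u : 0 < a -> measurable_fun setT u ->
  (\int[mu]_x (a * u x) = a * \int[mu]_x u x)%R.
Proof.
move=> a0 /measurable_EFinP mu_; rewrite /Rintegral.
under eq_integral do rewrite EFinM.
rewrite integralE (ge0_funeposM _ (ltW a0)) (ge0_funenegM _ (ltW a0)).
rewrite ge0_integralZl ?lee_fin ?(ltW a0)//; last exact: measurable_funepos.
rewrite ge0_integralZl ?lee_fin ?(ltW a0)//; last exact: measurable_funeneg.
rewrite [in RHS]integralE.
have : (0 <= \int[mu]_x (EFin \o u)^\+ x)%E by exact: integral_ge0.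
have : (0 <= \int[mu]_x (EFin \o u)^\- x)%E by exact: integral_ge0.
move: (integral _ _ _) (integral _ _ _) => [r| |] [s| |]//= _ _.
- by rewrite mulrBr.
- by rewrite gt0_muley ?lte_fin//= mulr0.
- by rewrite gt0_muley ?lte_fin//= mulr0.
- by rewrite gt0_muley ?lte_fin//= mulr0.
Qed.

End square_integrable.

Lemma sqr_adde_le (R : realType) (a b : \bar R) : (0 <= a)%E -> (0 <= b)%E ->
  ((a + b) * (a + b) <= 2%:E * (a * a) + 2%:E * (b * b))%E.
Proof.
move: a b => [a| |] [b| |] //= a0 b0; last first.
- by rewrite !mulyy !gt0_muley// leey.
- by rewrite mulyy gt0_muley// leey.
- by rewrite addey// mulyy gt0_muley// addey// leey.
- rewrite -[leLHS]/(((a + b) * (a + b))%:E) -[leRHS]/((2 * (a * a) + 2 * (b * b))%:E).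
  by rewrite lee_fin; have := sqr_ge0 (a - b); nra.
Qed.

(** * The Rollnik kernel and its Riesz factorization *)

Section rollnik_theory.
Variables (R : realType) (d : nat) (alpha : R).
Local Notation T := (measurableTypeR R).
Local Notation Rd := (d.-tuple T).
Local Notation mu := (@lebesgue_Rd R d).
Hypotheses (alpha0 : 0 < alpha) (alphad : alpha < d%:R) (dalpha : d%:R < 2 * alpha).
Implicit Types (V W : Rd -> R[i]) (f g : Rd -> R).

Local Notation h := (d%:R / 2 : R).
(** The order alpha - d/2 of the Riesz potential is 2p, and the Rollnik kernel is |x-y|^(-2b) with b
    = h - 2p. The assumption d < 2 alpha gives p > 0, and alpha < d gives b > 0. *)
Let p : R := (alpha - h) / 2.
Let b : R := d%:R - alpha.

Let d0 : (0 < d)%N.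
Proof. by rewrite -(ltr0n R); exact: lt_trans alphad. Qed.

Let p0 : 0 < p.
Proof. by rewrite /p; move: dalpha; lra. Qed.

Let b0 : 0 < b.
Proof. by rewrite /b; move: alphad; lra. Qed.

Let bE : h - 2 * p = b.
Proof. by rewrite /b /p; field. Qed.

Let hp0 : 0 < h - 2 * p.
Proof. by rewrite bE. Qed.

Let c : R := riesz_constant d p.

Let c0 : 0 < c.
Proof. exact: riesz_constant_gt0. Qed.

Local Notation K := (@riesz_kernel R d b).

(** Divided by the root of [c] so that k composed with itself is exactly [K]. *)
Let k (x z : Rd) : R := (Num.sqrt c)^-1 * riesz_kernel (h - p) x z.

Let k0 x z : 0 <= k x z.
Proof. by rewrite mulr_ge0 ?riesz_kernel_ge0// invr_ge0. Qed.

Let K0 x y : 0 <= K x y.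
Proof. exact: riesz_kernel_ge0. Qed.

Let mk : measurable_fun setT (fun q : Rd * Rd => k q.1 q.2).
Proof. by apply: measurable_funM => //; exact: measurable_riesz_kernel. Qed.

Let mK : measurable_fun setT (fun q : Rd * Rd => K q.1 q.2).
Proof. exact: measurable_riesz_kernel. Qed.

Let kkK y : {ae mu, forall x, (K x y)%:E = (\int[mu]_z (k x z * k y z)%:E)%E}.
Proof.
have FF := ae_filter_ringOfSetsType mu.
apply: (@filterS _ _ FF _ _ _ (ae_lebesgue_Rd_neq y d0)) => x xy.
transitivity (c^-1%:E * \int[mu]_z
  (riesz_kernel (h - p) x z * riesz_kernel (h - p) y z)%:E)%E.
  by rewrite riesz_composition// -EFinM bE -/c mulKf// gt_eqF.
rewrite -ge0_integralZl//; last 3 first.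
- by apply/measurable_EFinP/measurable_funM; exact: measurable_riesz_kernel.
- by move=> z _; rewrite lee_fin mulr_ge0 ?riesz_kernel_ge0.
- by rewrite lee_fin invr_ge0 ltW.
apply: eq_integral => z _; rewrite -EFinM /k mulrACA -invfM.
by rewrite -expr2 sqr_sqrtr// ltW.
Qed.

(** * Energy and form as squared L^2 norms of potentials *)

Local Notation pot := (potential mu k).
Local Notation epot := (epotential mu k).

Lemma rollnik_energyE V : rollnik_energy alpha V =
  (\int[mu]_y \int[mu]_x (normc (V x) * normc (V y) * K x y)%:E)%E.
Proof.
apply: eq_integral => y _; apply: eq_integral => x _.
rewrite eucl_dist_powR /riesz_kernel powRN; congr (_ / (_ `^ _))%:E.
by rewrite /b; field.
Qed.

Lemma rollnik_energy_potential V : measurable_funC V ->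
  (rollnik_energy alpha V =
   \int[mu]_z (epot (fun x => normc (V x)) z * epot (fun x => normc (V x)) z))%E.
Proof.
move=> mV; have mN := measurable_normc mV; rewrite rollnik_energyE.
by apply: kernel_energyE => // x; exact: normc_ge0.
Qed.

Let Re_ V x : R := complex.Re (V x).
Let Im_ V x : R := complex.Im (V x).
Let nV V x : R := normc (V x).

Let mRe V : rollnik_class alpha V -> measurable_fun setT (Re_ V).
Proof. by case=> -[]. Qed.

Let mIm V : rollnik_class alpha V -> measurable_fun setT (Im_ V).
Proof. by case=> -[]. Qed.

Let mN V : rollnik_class alpha V -> measurable_fun setT (nV V).
Proof. by case=> mV _; exact: measurable_normc. Qed.

Let nV_ge0 V x : 0 <= nV V x.
Proof. exact: normc_ge0. Qed.

Let energy_lty V f g : rollnik_class alpha V ->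
  measurable_fun setT f -> measurable_fun setT g ->
  (forall x, `|f x| <= nV V x) -> (forall x, `|g x| <= nV V x) ->
  (\int[mu]_y \int[mu]_x (`|f x| * `|g y| * K x y)%:E < +oo)%E.
Proof.
move=> SV mf mg fV gV; have mV := mN SV; case: SV => _; rewrite rollnik_energyE.
have mF (u v : Rd -> R) : measurable_fun setT u -> measurable_fun setT v ->
    measurable_fun setT (fun q : Rd * Rd => (u q.1 * v q.2 * K q.1 q.2)%:E).
  move=> mu_ mv; apply/measurable_EFinP; apply: measurable_funM => //.
  by apply: measurable_funM; exact: measurableT_comp.
have mnf : measurable_fun setT (fun x => `|f x|) by exact: measurableT_comp.
have mng : measurable_fun setT (fun x => `|g x|) by exact: measurableT_comp.
apply: le_lt_trans; apply: ge0_le_integral => //.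
- by move=> y _; apply: integral_ge0 => x _; rewrite lee_fin !mulr_ge0.
- apply: (measurable_fun_fubini_tonelli_G _ (mF _ _ mnf mng)) => q.
  by rewrite lee_fin !mulr_ge0.
- apply: (measurable_fun_fubini_tonelli_G _ (mF _ _ mV mV)) => q.
  by rewrite lee_fin !mulr_ge0.
move=> y _; apply: ge0_le_integral => //.
- by move=> x _; rewrite lee_fin !mulr_ge0.
- exact: (measurable_fun_pair1 y (mF _ _ mnf mng)).
- exact: (measurable_fun_pair1 y (mF _ _ mV mV)).
- move=> x _; rewrite lee_fin; apply: ler_wpM2r => //.
  exact: ler_pM.
Qed.

Let Re_le V x : `|Re_ V x| <= nV V x. Proof. exact: normr_Re_le. Qed.
Let Im_le V x : `|Im_ V x| <= nV V x. Proof. exact: normr_Im_le. Qed.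
Let nV_le V x : `|nV V x| <= nV V x. Proof. by rewrite ger0_norm. Qed.

Let row f g y : R := \int[mu]_x (f x * g y * K x y).

(** [rollnik_form] iterates real-valued integrals, which default to 0 where they diverge. Off a null
    set of y the inner one agrees with the extended integral in [kernel_form_potential]. *)
Let energy_row f g : measurable_fun setT f -> measurable_fun setT g ->
  (\int[mu]_y \int[mu]_x (`|f x| * `|g y| * K x y)%:E < +oo)%E ->
  [/\ {ae mu, forall y, mu.-integrable setT (fun x => (f x * g y * K x y)%:E)},
    mu.-integrable setT (EFin \o row f g) &
    (\int[mu]_y row f g y)%R = (\int[mu]_z (pot f z * pot g z))%R].
Proof.
move=> mf mg fgoo.
have iK := integrable_kernel K0 mK mf mg fgoo.
have iF := integrable_kernel_form K0 mK mf mg fgoo.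
have mrow : measurable_fun setT (EFin \o row f g).
  apply/measurable_EFinP; apply: (measurableT_comp (f := fine)).
    exact: fine_measurable.
  exact: (measurable_int mu iF).
split; first exact: ae_integrable2 iK.
  apply: le_integrable iF => // y _ /=.
  rewrite /row /Rintegral; move: (integral _ _ _) => [r| |] //=.
    by rewrite normr0 leey.
  by rewrite normr0 leey.
rewrite /Rintegral -(kernel_form_potential k0 K0 mk mK kkK mf mg fgoo).
congr fine; apply: ae_eq_integral => //; first exact: (measurable_int mu iF).
have FF := ae_filter_ringOfSetsType mu.
apply: (@filterS _ _ FF _ _ _ (integrable_ae measurableT iF)) => y /(_ I) Fy _.
by rewrite /= /row /Rintegral fineK.
Qed.

(** The real and imaginary parts of V(x) times the conjugate of V(y) are sums of two real products,
    with sign s = 1 and s = -1. *)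
Let double_Rintegral f1 g1 f2 g2 (s : R) :
  measurable_fun setT f1 -> measurable_fun setT g1 ->
  measurable_fun setT f2 -> measurable_fun setT g2 ->
  (\int[mu]_y \int[mu]_x (`|f1 x| * `|g1 y| * K x y)%:E < +oo)%E ->
  (\int[mu]_y \int[mu]_x (`|f2 x| * `|g2 y| * K x y)%:E < +oo)%E ->
  (\int[mu]_y (\int[mu]_x (f1 x * g1 y * K x y + s * (f2 x * g2 y * K x y))) =
  (\int[mu]_z (pot f1 z * pot g1 z)) + s * (\int[mu]_z (pot f2 z * pot g2 z)))%R.
Proof.
move=> mf1 mg1 mf2 mg2 oo1 oo2.
have [i1 r1 <-] := energy_row mf1 mg1 oo1.
have [i2 r2 <-] := energy_row mf2 mg2 oo2.
have sr2 : mu.-integrable setT (EFin \o (fun y => s * row f2 g2 y)).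
  have := integrableZl measurableT s r2.
  by apply: eq_integrable => // y _; rewrite /= EFinM.
rewrite -(RintegralZl s measurableT r2) -(RintegralD measurableT r1 sr2).
congr fine; apply: ae_eq_integral => //.
- apply/measurable_EFinP; apply: (measurableT_comp (f := fine)).
    exact: fine_measurable.
  apply: (measurable_fun_integral1 mu (F := fun q : Rd * Rd =>
    (f1 q.1 * g1 q.2 * K q.1 q.2 + s * (f2 q.1 * g2 q.2 * K q.1 q.2))%:E)).
  apply/measurable_EFinP; apply: measurable_funD.
    by apply: measurable_funM => //; apply: measurable_funM; exact: measurableT_comp.
  apply: measurable_funM => //.
  by apply: measurable_funM => //; apply: measurable_funM; exact: measurableT_comp.
- have := integrableD measurableT r1 sr2; exact: measurable_int.
have FF := ae_filter_ringOfSetsType mu.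
apply: (@filterS2 _ _ FF _ _ _ _ i1 i2) => y iy1 iy2 _; congr EFin.
rewrite RintegralD//; last first.
  have := integrableZl measurableT s iy2.
  by apply: eq_integrable => // x _; rewrite /= EFinM.
by rewrite RintegralZl.
Qed.

(** The complex potential of V; the trinorm is the L^2 norm of its modulus ([trinormE]). *)
Let cpot V z : R[i] := pot (Re_ V) z +i* pot (Im_ V) z.

Let sqr_cpot V z : normc (cpot V z) ^+ 2 = pot (Re_ V) z * pot (Re_ V) z + pot (Im_ V) z * pot (Im_ V) z.
Proof. by rewrite sqr_normc /= !expr2. Qed.

Let measurable_cpot V : rollnik_class alpha V -> measurable_fun setT (fun z => normc (cpot V z)).
Proof.
move=> SV; apply: measurable_normc; split; apply: measurable_potential => //;
  by [exact: mRe|exact: mIm].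
Qed.

Let cpot_fin V : rollnik_class alpha V ->
  mu.-integrable setT (fun z => (normc (cpot V z) ^+ 2)%:E).
Proof.
move=> SV.
have i1 := integrable_potentialM k0 K0 mk mK kkK (mRe SV) (mRe SV)
  (energy_lty SV (mRe SV) (mRe SV) (Re_le V) (Re_le V)).
have i2 := integrable_potentialM k0 K0 mk mK kkK (mIm SV) (mIm SV)
  (energy_lty SV (mIm SV) (mIm SV) (Im_le V) (Im_le V)).
have := integrableD measurableT i1 i2.
by apply: eq_integrable => // z _; rewrite sqr_cpot.
Qed.

Let cpot_lty V : rollnik_class alpha V ->
  (\int[mu]_z (normc (cpot V z) ^+ 2)%:E < +oo)%E.
Proof.
move=> /cpot_fin/integrableP[_]; apply: le_lt_trans.
rewrite le_eqVlt; apply/orP; left; apply/eqP; apply: eq_integral => z _.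
by rewrite gee0_abs// lee_fin sqr_ge0.
Qed.

Let rollnik_formE V : rollnik_class alpha V ->
  rollnik_form alpha V = (\int[mu]_z (pot (Re_ V) z * pot (Re_ V) z) +
                          \int[mu]_z (pot (Im_ V) z * pot (Im_ V) z))%:C.
Proof.
move=> SV; have mR := mRe SV; have mI := mIm SV.
have eRR := energy_lty SV mR mR (Re_le V) (Re_le V).
have eII := energy_lty SV mI mI (Im_le V) (Im_le V).
have eRI := energy_lty SV mR mI (Re_le V) (Im_le V).
have eIR := energy_lty SV mI mR (Im_le V) (Re_le V).
have KE x y : eucl_dist x y `^ (2 * alpha - 2 * d%:R) = K x y.
  by rewrite eucl_dist_powR /riesz_kernel; congr (_ `^ _); rewrite /b; field.
have ReE x y : complex.Re (V x * (V y)^* * (eucl_dist x y `^ (2 * alpha - 2 * d%:R))%:C) =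
    Re_ V x * Re_ V y * K x y + 1 * (Im_ V x * Im_ V y * K x y).
  by rewrite KE /Re_ /Im_; case: (V x) (V y) => a1 b1 [a2 b2] /=; ring.
have ImE x y : complex.Im (V x * (V y)^* * (eucl_dist x y `^ (2 * alpha - 2 * d%:R))%:C) =
    Im_ V x * Re_ V y * K x y + - 1 * (Re_ V x * Im_ V y * K x y).
  by rewrite KE /Re_ /Im_; case: (V x) (V y) => a1 b1 [a2 b2] /=; ring.
rewrite /rollnik_form /integralC /=.
under eq_Rintegral do under eq_Rintegral do rewrite ReE.
under [X in _ +i* X]eq_Rintegral do under eq_Rintegral do rewrite ImE.
rewrite (double_Rintegral 1 mR mR mI mI eRR eII) mul1r.
(* The imaginary part is the difference of two mixed integrals that agree after commuting the
   factors. *)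
rewrite (double_Rintegral (-1) mI mR mR mI eIR eRI).
congr (_ +i* _); rewrite mulN1r.
by under eq_Rintegral do rewrite mulrC; rewrite subrr.
Qed.

Let rollnik_form_cpot V : rollnik_class alpha V ->
  complex.Re (rollnik_form alpha V) = fine (\int[mu]_z (normc (cpot V z) ^+ 2)%:E)%E.
Proof.
move=> SV; rewrite rollnik_formE//=.
rewrite -RintegralD//; last 2 first.
- exact: (integrable_potentialM k0 K0 mk mK kkK (mRe SV) (mRe SV)
    (energy_lty SV (mRe SV) (mRe SV) (Re_le V) (Re_le V))).
- exact: (integrable_potentialM k0 K0 mk mK kkK (mIm SV) (mIm SV)
    (energy_lty SV (mIm SV) (mIm SV) (Im_le V) (Im_le V))).
by congr fine; apply: eq_integral => z _; rewrite sqr_cpot.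
Qed.

Let trinormE V : rollnik_class alpha V ->
  rollnik_trinorm alpha V = l2 mu (fun z => normc (cpot V z)).
Proof. by move=> SV; rewrite /rollnik_trinorm rollnik_form_cpot. Qed.

(** * Finiteness of the potentials and vector-space structure of the class *)

Let ae_filter : Filter (almost_everywhere mu) := ae_filter_ringOfSetsType mu.

Let epot_ge0 V z : (0 <= epot (nV V) z)%E.
Proof. by apply: epotential_ge0 => // x; exact: normc_ge0. Qed.

Let mepot V : measurable_funC V -> measurable_fun setT (epot (nV V)).
Proof. by move=> mV; apply: measurable_epotential => //; exact: measurable_normc. Qed.

Let epot_lty V : rollnik_class alpha V -> {ae mu, forall z, (epot (nV V) z < +oo)%E}.
Proof.
move=> [mV]; rewrite (rollnik_energy_potential mV) => /ge0_integral_lty_ae.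
move=> /(_ (emeasurable_funM (mepot mV) (mepot mV)) (fun z => mule_ge0 (epot_ge0 V z) (epot_ge0 V z))).
apply: (@filterS _ _ ae_filter) => z; have := epot_ge0 V z; rewrite -/(nV V).
by move: (epot _ z) => [r _ _| |//]; rewrite ?ltry// mulyy.
Qed.

Let integrable_pot V f : rollnik_class alpha V -> measurable_fun setT f ->
  (forall x, `|f x| <= nV V x) ->
  {ae mu, forall z, mu.-integrable setT (fun x => (f x * k x z)%:E)}.
Proof.
move=> SV mf fV; apply: (@filterS _ _ ae_filter _ _ _ (epot_lty SV)) => z ez.
have mk1 : measurable_fun setT (k ^~ z) by exact: (measurable_fun_pair1 z mk).
apply/integrableP; split; first exact/measurable_EFinP/measurable_funM.
apply: le_lt_trans ez; apply: ge0_le_integral => //.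
- apply: measurableT_comp => //; exact/measurable_EFinP/measurable_funM.
- by apply/measurable_EFinP/measurable_funM => //; exact: mN.
- move=> x _; rewrite /= lee_fin normrM (ger0_norm (k0 _ _)).
  by rewrite ler_wpM2r.
Qed.

Let energy_ae V W : measurable_funC V -> measurable_funC W -> ae_eq mu setT V W ->
  rollnik_energy alpha V = rollnik_energy alpha W.
Proof.
move=> mV mW VW; rewrite (rollnik_energy_potential mV) (rollnik_energy_potential mW).
have -> // : epot (fun x => normc (V x)) = epot (fun x => normc (W x)).
apply/funext => z.
have mk1 : measurable_fun setT (k ^~ z) by exact: (measurable_fun_pair1 z mk).
apply: ge0_ae_eq_integral => //.
- by apply/measurable_EFinP/measurable_funM => //; exact: measurable_normc.
- by apply/measurable_EFinP/measurable_funM => //; exact: measurable_normc.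
- by move=> x _; rewrite lee_fin mulr_ge0 ?normc_ge0.
- by move=> x _; rewrite lee_fin mulr_ge0 ?normc_ge0.
- by apply: (@filterS _ _ ae_filter _ _ _ VW) => x /= VWx xT; rewrite VWx.
Qed.

Let cpot_ae V W z : rollnik_class alpha V -> rollnik_class alpha W ->
  ae_eq mu setT V W -> cpot V z = cpot W z.
Proof.
move=> SV SW VW; have mk1 : measurable_fun setT (k ^~ z) by exact: (measurable_fun_pair1 z mk).
rewrite /cpot; congr (_ +i* _); congr fine; apply: ae_eq_integral => //.
- by apply/measurable_EFinP/measurable_funM => //; exact: mRe.
- by apply/measurable_EFinP/measurable_funM => //; exact: mRe.
- by apply: (@filterS _ _ ae_filter _ _ _ VW) => x /= VWx xT; rewrite /Re_ VWx.
- by apply/measurable_EFinP/measurable_funM => //; exact: mIm.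
- by apply/measurable_EFinP/measurable_funM => //; exact: mIm.
- by apply: (@filterS _ _ ae_filter _ _ _ VW) => x /= VWx xT; rewrite /Im_ VWx.
Qed.

Let measurable_funCD V W : measurable_funC V -> measurable_funC W ->
  measurable_funC (fun x => V x + W x).
Proof.
move=> [mV1 mV2] [mW1 mW2]; split.
  rewrite (_ : (fun x => _) = (fun x => complex.Re (V x) + complex.Re (W x))).
    exact: measurable_funD.
  by apply/funext => x; case: (V x) (W x) => ? ? [].
rewrite (_ : (fun x => _) = (fun x => complex.Im (V x) + complex.Im (W x))).
  exact: measurable_funD.
by apply/funext => x; case: (V x) (W x) => ? ? [].
Qed.

Let measurable_funCZ (a : R[i]) V : measurable_funC V -> measurable_funC (fun x => a * V x).
Proof.
move=> [mV1 mV2]; case: a => a1 a2; split.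
  rewrite (_ : (fun x => _) = (fun x => a1 * complex.Re (V x) - a2 * complex.Im (V x))).
    by apply: measurable_funB; exact: measurable_funM.
  by apply/funext => x; case: (V x).
rewrite (_ : (fun x => _) = (fun x => a1 * complex.Im (V x) + a2 * complex.Re (V x))).
  by apply: measurable_funD; exact: measurable_funM.
by apply/funext => x; case: (V x).
Qed.

Lemma rollnik_class_ae V W : rollnik_class alpha V -> measurable_funC W ->
  ae_eq mu setT V W -> rollnik_class alpha W.
Proof. by move=> [mV Voo] mW VW; split; [exact: mW|rewrite -(energy_ae mV mW VW)]. Qed.

Lemma rollnik_class0 : rollnik_class alpha (fun _ : Rd => 0 : R[i]).
Proof.
split; first by split; exact: measurable_cst.
rewrite (_ : rollnik_energy _ _ = 0%E) ?ltry//.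
apply: integral0_eq => y _; apply: integral0_eq => x _.
by rewrite normc0 !mul0r.
Qed.

(** The potential of |V+W| is at most the sum of those of |V| and |W|, and (a+b)^2 <= 2a^2 +
    2b^2. *)
Lemma rollnik_classD V W : rollnik_class alpha V -> rollnik_class alpha W ->
  rollnik_class alpha (fun x => V x + W x).
Proof.
move=> SV SW; have [mV Voo] := SV; have [mW Woo] := SW.
have mVW := measurable_funCD mV mW; split; first exact: mVW.
rewrite (rollnik_energy_potential mVW).
have mE V' : measurable_funC V' -> measurable_fun setT (fun z => (epot (nV V') z * epot (nV V') z)%E).
  by move=> mV'; apply: emeasurable_funM; exact: mepot.
have E0 V' z : (0 <= epot (nV V') z * epot (nV V') z)%E by rewrite mule_ge0.
apply: (@le_lt_trans _ _ (\int[mu]_z (2%:E * (epot (nV V) z * epot (nV V) z) +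
   2%:E * (epot (nV W) z * epot (nV W) z)))%E).
  apply: ge0_le_integral.
  - exact: measurableT.
  - by move=> z _; exact: (E0 (fun x => V x + W x)).
  - exact: (mE _ mVW).
  - by apply: emeasurable_funD; apply: emeasurable_funM => //; exact: mE.
  - move=> z _; apply: le_trans (sqr_adde_le (epot_ge0 V z) (epot_ge0 W z)).
    have mk1 : measurable_fun setT (k ^~ z) by exact: (measurable_fun_pair1 z mk).
    have H : (epot (nV (fun x => V x + W x)%R) z <= epot (nV V) z + epot (nV W) z)%E.
      have mek V' : measurable_funC V' -> measurable_fun setT (fun x => (nV V' x * k x z)%:E).
        by move=> mV'; apply/measurable_EFinP/measurable_funM => //; exact: measurable_normc.
      rewrite /epotential -ge0_integralD//; first last.
      - exact: mek.
      - by move=> x _; rewrite lee_fin mulr_ge0.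
      - exact: mek.
      - by move=> x _; rewrite lee_fin mulr_ge0.
      apply: ge0_le_integral => //.
      - by move=> x _; rewrite lee_fin mulr_ge0.
      - exact: mek.
      - by apply: emeasurable_funD; exact: mek.
      - move=> x _; rewrite -EFinD lee_fin -mulrDl ler_wpM2r//.
        exact: le_normcD.
    have P := epot_ge0 (fun x => V x + W x) z; exact: (lee_pmul P P H H).
have two0 : (0 <= 2%:E :> \bar R)%E by rewrite lee_fin.
rewrite ge0_integralD//; first last.
- by apply: emeasurable_funM => //; exact: mE.
- by move=> z _; rewrite mule_ge0.
- by apply: emeasurable_funM => //; exact: mE.
- by move=> z _; rewrite mule_ge0.
rewrite !ge0_integralZl//; try exact: mE.
rewrite -(rollnik_energy_potential mV) -(rollnik_energy_potential mW).
by apply: lte_add_pinfty; [exact: (lte_mul_pinfty two0 isT Voo)|exact: (lte_mul_pinfty two0 isT Woo)].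
Qed.

Let energyZ (a : R[i]) V : measurable_funC V ->
  (rollnik_energy alpha (fun x => a * V x)%R = (normc a ^+ 2)%:E * rollnik_energy alpha V)%E.
Proof.
move=> mV; rewrite (rollnik_energy_potential mV).
rewrite (rollnik_energy_potential (measurable_funCZ a mV)).
have aE z : epot (fun x => normc (a * V x)) z = ((normc a)%:E * epot (nV V) z)%E.
  have mk1 : measurable_fun setT (k ^~ z) by exact: (measurable_fun_pair1 z mk).
  rewrite /epotential -ge0_integralZl//; last 3 first.
  - by apply/measurable_EFinP/measurable_funM => //; exact: measurable_normc.
  - by move=> x _; rewrite lee_fin mulr_ge0.
  - by rewrite lee_fin normc_ge0.
  by apply: eq_integral => x _; rewrite -EFinM normcM -[in LHS]mulrA.
rewrite -ge0_integralZl//; last 3 first.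
- by apply: emeasurable_funM; exact: mepot.
- by move=> z _; exact: (mule_ge0 (epot_ge0 V z) (epot_ge0 V z)).
- by rewrite lee_fin sqr_ge0.
by apply: eq_integral => z _; rewrite !aE muleACA -EFinM expr2.
Qed.

Lemma rollnik_classZ (a : R[i]) V : rollnik_class alpha V ->
  rollnik_class alpha (fun x => a * V x).
Proof.
move=> [mV Voo]; split; first exact: measurable_funCZ.
have a0 : (0 <= (normc a ^+ 2)%:E)%E by rewrite lee_fin sqr_ge0.
by rewrite (energyZ a mV); exact: (lte_mul_pinfty a0 isT Voo).
Qed.

(** |V| as a complex-valued function: [rollnik_norm] of V is the trinorm of |V| ([normE]), so facts
    on the trinorm transfer. *)
Let absC V : Rd -> R[i] := fun x => (nV V x)%:C.

Let normc_absC V x : normc (absC V x) = nV V x.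
Proof. exact: normc_real. Qed.

Let energy_absC V : rollnik_energy alpha (absC V) = rollnik_energy alpha V.
Proof.
by apply: eq_integral => y _; apply: eq_integral => x _; rewrite !normc_absC.
Qed.

Let class_absC V : rollnik_class alpha V -> rollnik_class alpha (absC V).
Proof.
move=> SV; have [mV Voo] := SV; split; last by rewrite energy_absC.
by split; [exact: mN|exact: measurable_cst].
Qed.

Let cpot_absC V z : cpot (absC V) z = (pot (nV V) z)%:C.
Proof.
rewrite /cpot; congr (_ +i* _); rewrite /potential /Rintegral integral0_eq//.
by move=> x _; rewrite /Im_ /= mul0r.
Qed.

Let pot_nV_ge0 V z : 0 <= pot (nV V) z.
Proof. by apply: Rintegral_ge0 => x _; rewrite mulr_ge0. Qed.

Let energy_cpot V : rollnik_class alpha V ->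
  (rollnik_energy alpha V = \int[mu]_z (normc (cpot (absC V) z) ^+ 2)%:E)%E.
Proof.
move=> SV; have [mV Voo] := SV; rewrite (rollnik_energy_potential mV).
apply: ge0_ae_eq_integral => //.
- by apply: emeasurable_funM; exact: mepot.
- apply/measurable_EFinP; apply: measurable_funX; apply: measurable_cpot.
  exact: class_absC.
- by move=> z _; exact: (mule_ge0 (epot_ge0 V z) (epot_ge0 V z)).
- by move=> z _; rewrite lee_fin sqr_ge0.
- apply: (@filterS _ _ ae_filter _ _ _ (epot_lty SV)) => z ez _.
  rewrite cpot_absC normc_real// expr2 EFinM /potential /Rintegral fineK//.
  by rewrite ge0_fin_numE// -/(epot _ _).
Qed.

Let normE V : rollnik_class alpha V -> rollnik_norm alpha V = rollnik_trinorm alpha (absC V).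
Proof.
by move=> SV; rewrite (trinormE (class_absC SV)) /rollnik_norm (energy_cpot SV).
Qed.

Let cpot_intg V : rollnik_class alpha V -> {ae mu, forall z,
  mu.-integrable setT (EFin \o (fun x => Re_ V x * k x z)) /\
  mu.-integrable setT (EFin \o (fun x => Im_ V x * k x z))}.
Proof.
move=> SV; have HR := integrable_pot SV (mRe SV) (Re_le V).
have HI := integrable_pot SV (mIm SV) (Im_le V).
exact: (@filterS2 _ _ ae_filter _ _ _ _ HR HI).
Qed.

Let cpotD V W : rollnik_class alpha V -> rollnik_class alpha W ->
  {ae mu, forall z, cpot (fun x => V x + W x) z = cpot V z + cpot W z}.
Proof.
move=> SV SW.
apply: (@filterS2 _ _ ae_filter _ _ _ _ (cpot_intg SV) (cpot_intg SW)).
move=> z [iVR iVI] [iWR iWI].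
have -> : cpot V z + cpot W z = (pot (Re_ V) z + pot (Re_ W) z) +i*
  (pot (Im_ V) z + pot (Im_ W) z) by [].
rewrite -(RintegralD measurableT iVR iWR) -(RintegralD measurableT iVI iWI).
by congr (_ +i* _); apply: eq_Rintegral => x _; rewrite -mulrDl;
  congr (_ * _); rewrite /Re_ /Im_; case: (V x) (W x) => ? ? [].
Qed.

Let cpotZ (a : R[i]) V : rollnik_class alpha V ->
  {ae mu, forall z, cpot (fun x => a * V x) z = a * cpot V z}.
Proof.
move=> SV; apply: (@filterS _ _ ae_filter _ _ _ (cpot_intg SV)) => z [iR iI].
have sc (u : Rd -> R) (s : R) : mu.-integrable setT (EFin \o u) ->
    mu.-integrable setT (EFin \o (fun x => s * u x)).
  move=> iu; have := integrableZl measurableT s iu.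
  by apply: eq_integrable => // x _; rewrite /= EFinM.
case: a => a1 a2.
have -> : (a1 +i* a2) * cpot V z = (a1 * pot (Re_ V) z + - a2 * pot (Im_ V) z) +i*
    (a1 * pot (Im_ V) z + a2 * pot (Re_ V) z).
  by rewrite mulNr.
rewrite -!(RintegralZl _ measurableT iR) -!(RintegralZl _ measurableT iI).
rewrite -(RintegralD measurableT (sc _ a1 iR) (sc _ (- a2) iI)).
rewrite -(RintegralD measurableT (sc _ a1 iI) (sc _ a2 iR)).
by congr (_ +i* _); apply: eq_Rintegral => x _; rewrite /Re_ /Im_;
  case: (V x) => v1 v2 /=; ring.
Qed.

(** * The norm axioms *)

Let trinorm_ae V W : rollnik_class alpha V -> rollnik_class alpha W ->
  ae_eq mu setT V W -> rollnik_trinorm alpha V = rollnik_trinorm alpha W.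
Proof.
move=> SV SW VW; rewrite (trinormE SV) (trinormE SW); congr (l2 mu _).
by apply/funext => z; rewrite (cpot_ae z SV SW VW).
Qed.

Let trinormZ (a : R[i]) V : rollnik_class alpha V ->
  rollnik_trinorm alpha (fun x => a * V x) = normc a * rollnik_trinorm alpha V.
Proof.
move=> SV; have SaV := rollnik_classZ a SV.
rewrite (trinormE SV) (trinormE SaV).
rewrite -(l2Z (normc_ge0 a) (measurable_cpot SV) (cpot_lty SV)).
apply: l2_ae; first exact: (measurable_cpot SaV).
  by apply: measurable_funM => //; exact: measurable_cpot.
apply: (@filterS _ _ ae_filter _ _ _ (cpotZ a SV)) => z ->; exact: normcM.
Qed.

Let trinormD V W : rollnik_class alpha V -> rollnik_class alpha W ->
  rollnik_trinorm alpha (fun x => V x + W x) <=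
  rollnik_trinorm alpha V + rollnik_trinorm alpha W.
Proof.
move=> SV SW; have SVW := rollnik_classD SV SW.
rewrite (trinormE SV) (trinormE SW) (trinormE SVW).
apply: (l2_triangle (measurable_cpot SVW) (measurable_cpot SV) (measurable_cpot SW)
  (cpot_lty SVW) (cpot_lty SV) (cpot_lty SW)).
apply: (@filterS _ _ ae_filter _ _ _ (cpotD SV SW)) => z ->.
by rewrite (ger0_norm (normc_ge0 _)); exact: le_normcD.
Qed.

(** A vanishing Riesz potential makes the quadratic form zero, and the form keeps no trace of its
    factorization, so the Gaussian argument of [riesz_form_inj] applies. *)
Let pot_inj V f : rollnik_class alpha V -> measurable_fun setT f ->
  (forall x, `|f x| <= nV V x) -> {ae mu, forall z, pot f z = 0} ->
  {ae mu, forall x, f x = 0}.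
Proof.
move=> SV mf fV pf0; have foo := energy_lty SV mf mf fV fV.
apply: (riesz_form_inj d0 b0 mf foo).
rewrite (kernel_form_potential k0 K0 mk mK kkK mf mf foo).
rewrite (@ge0_ae_eq_integral _ _ _ mu setT _ (cst 0%E)) ?integral0//.
- by apply/measurable_EFinP; apply: measurable_funM; exact: measurable_potential.
- by move=> z _; rewrite lee_fin -expr2 sqr_ge0.
- by apply: (@filterS _ _ ae_filter _ _ _ pf0) => z -> _; rewrite mulr0.
Qed.

Let trinorm_eq0 V : rollnik_class alpha V -> rollnik_trinorm alpha V = 0 ->
  ae_eq mu setT V (fun=> 0).
Proof.
move=> SV; rewrite (trinormE SV) => V0; have := sqr_l2 (cpot_lty SV).
rewrite V0 expr0n => /esym/ge0_integral_eq0_ae H.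
have {}H : {ae mu, forall z, pot (Re_ V) z = 0 /\ pot (Im_ V) z = 0}.
  have mpc2 : measurable_fun setT (fun z => (normc (cpot V z) ^+ 2)%:E).
    by apply/measurable_EFinP/measurable_funX; exact: measurable_cpot.
  have cpot2 z : (0 <= (normc (cpot V z) ^+ 2)%:E)%E by rewrite lee_fin sqr_ge0.
  apply: (@filterS _ _ ae_filter _ _ _ (H mpc2 cpot2)) => z /eqP.
  rewrite eqe sqrf_eq0 => /eqP/eq0_normc pcz.
  by split; [have := congr1 (@complex.Re _) pcz|have := congr1 (@complex.Im _) pcz].
have HR : {ae mu, forall z, pot (Re_ V) z = 0}.
  by apply: (@filterS _ _ ae_filter _ _ _ H) => z [].
have HI : {ae mu, forall z, pot (Im_ V) z = 0}.
  by apply: (@filterS _ _ ae_filter _ _ _ H) => z [].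
apply: (@filterS2 _ _ ae_filter _ _ _ _ (pot_inj SV (mRe SV) (Re_le V) HR)
  (pot_inj SV (mIm SV) (Im_le V) HI)) => x.
by rewrite /Re_ /Im_; case: (V x) => v1 v2 /= -> -> _.
Qed.

Lemma rollnik_trinorm_is_norm : is_norm_on_classes mu
  (rollnik_class alpha) (rollnik_trinorm alpha : (Rd -> R[i]) -> R).
Proof.
split.
- by move=> V [].
- exact: rollnik_class_ae.
- exact: rollnik_class0.
- exact: rollnik_classD.
- exact: rollnik_classZ.
- exact: trinorm_ae.
- by move=> V _; exact: sqrtr_ge0.
- exact: trinorm_eq0.
- exact: trinormZ.
- exact: trinormD.
Qed.

Let rollnik_normZ (a : R[i]) V : rollnik_class alpha V ->
  rollnik_norm alpha (fun x => a * V x) = normc a * rollnik_norm alpha V.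
Proof.
move=> SV; rewrite (normE SV) (normE (rollnik_classZ a SV)).
rewrite -[normc a](normc_real (normc_ge0 a)) -(trinormZ _ (class_absC SV)).
congr (rollnik_trinorm _ _); apply/funext => x.
by rewrite /absC /nV normcM -rmorphM.
Qed.

(** As k is nonnegative, |V+W| <= |V|+|W| passes to the potentials at almost every point; Minkowski
    does the rest. *)
Let rollnik_normD V W : rollnik_class alpha V -> rollnik_class alpha W ->
  rollnik_norm alpha (fun x => V x + W x) <=
  rollnik_norm alpha V + rollnik_norm alpha W.
Proof.
move=> SV SW; have SVW := rollnik_classD SV SW.
rewrite (normE SV) (normE SW) (normE SVW).
have AV := class_absC SV; have AW := class_absC SW; have AVW := class_absC SVW.
rewrite (trinormE AV) (trinormE AW) (trinormE AVW).
apply: (l2_triangle (measurable_cpot AVW) (measurable_cpot AV) (measurable_cpot AW)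
  (cpot_lty AVW) (cpot_lty AV) (cpot_lty AW)).
have iV := integrable_pot SV (mN SV) (nV_le V).
have iW := integrable_pot SW (mN SW) (nV_le W).
have iVW := integrable_pot SVW (mN SVW) (nV_le _).
apply: (@filterS3 _ _ ae_filter _ _ _ _ _ iV iW iVW) => z iVz iWz iVWz.
rewrite (ger0_norm (normc_ge0 _)) !cpot_absC !(normc_real (pot_nV_ge0 _ _)).
rewrite -(RintegralD measurableT iVz iWz); apply: le_Rintegral => //.
  have := integrableD measurableT iVz iWz.
  by apply: eq_integrable => // x _; rewrite /= EFinD.
by move=> x _; rewrite -mulrDl ler_wpM2r//; exact: le_normcD.
Qed.

Let rollnik_norm_eq0 V : rollnik_class alpha V -> rollnik_norm alpha V = 0 ->
  ae_eq mu setT V (fun=> 0).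
Proof.
move=> SV; rewrite (normE SV) => /(trinorm_eq0 (class_absC SV)) V0.
apply: (@filterS _ _ ae_filter _ _ _ V0) => x /(_ I) [nV0] _.
exact: eq0_normc.
Qed.

Lemma rollnik_norm_is_norm : is_norm_on_classes mu
  (rollnik_class alpha) (rollnik_norm alpha : (Rd -> R[i]) -> R).
Proof.
split.
- by move=> V [].
- exact: rollnik_class_ae.
- exact: rollnik_class0.
- exact: rollnik_classD.
- exact: rollnik_classZ.
- move=> V W [mV _] [mW _] VW.
  by rewrite /rollnik_norm (energy_ae mV mW VW).
- by move=> V _; exact: sqrtr_ge0.
- exact: rollnik_norm_eq0.
- exact: rollnik_normZ.
- exact: rollnik_normD.
Qed.

Lemma rollnik_form_trinorm V : rollnik_class alpha V ->
  rollnik_form alpha V = (rollnik_trinorm alpha V ^+ 2)%:C.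
Proof.
move=> SV; have := rollnik_form_cpot SV; rewrite /rollnik_trinorm.
rewrite (rollnik_formE SV) /= => ->; rewrite sqr_sqrtr// fine_ge0//.
by apply: integral_ge0 => z _; rewrite lee_fin sqr_ge0.
Qed.

(** * Identification with Riesz potentials *)

Local Notation beta := (alpha - h).

Let riesz_weight x z : (eucl_dist x z `^ (d%:R - beta))^-1 = Num.sqrt c * k z x.
Proof.
rewrite /k mulrA mulfV ?gt_eqF ?sqrtr_gt0// mul1r riesz_kernelC.
rewrite eucl_dist_powR /riesz_kernel powRN; congr (_ `^ _)^-1.
by rewrite /p; field.
Qed.

Let sqrtc0 : 0 < Num.sqrt c. Proof. by rewrite sqrtr_gt0. Qed.

Lemma ae_riesz_converges V : rollnik_class alpha V ->
  {ae mu, forall x, riesz_converges beta V x}.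
Proof.
move=> SV; apply: (@filterS _ _ ae_filter _ _ _ (epot_lty SV)) => z ez.
have mk1 : measurable_fun setT (k ^~ z) by exact: (measurable_fun_pair1 z mk).
rewrite /riesz_converges.
under eq_integral do rewrite riesz_weight mulrCA EFinM.
rewrite ge0_integralZl//; last 2 first.
- by apply/measurable_EFinP/measurable_funM => //; exact: (mN SV).
- by move=> x _; rewrite lee_fin mulr_ge0// normc_ge0.
have s0 : (0 <= (Num.sqrt c)%:E)%E by rewrite lee_fin (ltW sqrtc0).
exact: (lte_mul_pinfty s0 isT ez).
Qed.

(** Valid at every z, also where the integral diverges, since [RintegralZl_gt0] respects the default
    values. *)
Let riesz_potentialE V z : rollnik_class alpha V ->
  riesz_potential beta V z =
  ((riesz_gamma d beta)^-1 * Num.sqrt c)%:C * cpot V z.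
Proof.
move=> SV.
have mk1 : measurable_fun setT (k ^~ z) by exact: (measurable_fun_pair1 z mk).
rewrite /riesz_potential /integralC rmorphM -mulrA; congr (_ * _).
have -> : (Num.sqrt c)%:C * cpot V z =
    (Num.sqrt c * pot (Re_ V) z) +i* (Num.sqrt c * pot (Im_ V) z).
  by rewrite /cpot; apply/eqP; rewrite eq_complex /= !mul0r subr0 addr0 !eqxx.
rewrite -(RintegralZl_gt0 _ sqrtc0 (measurable_funM (mRe SV) mk1)).
rewrite -(RintegralZl_gt0 _ sqrtc0 (measurable_funM (mIm SV) mk1)).
have ReZ (v : R[i]) r : complex.Re (v * r%:C) = complex.Re v * r.
  by case: v => v1 v2 /=; rewrite mulr0 subr0.
have ImZ (v : R[i]) r : complex.Im (v * r%:C) = complex.Im v * r.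
  by case: v => v1 v2 /=; rewrite mulr0 add0r.
congr (_ +i* _); apply: eq_Rintegral => x _; rewrite -fmorphV riesz_weight.
  by rewrite ReZ mulrCA.
by rewrite ImZ mulrCA.
Qed.

Let gamma_beta0 : 0 < riesz_gamma d beta.
Proof.
have u0 : 0 < beta / 2 by move: dalpha; lra.
have v0 : 0 < (d%:R - beta) / 2 by move: alphad alpha0; lra.
apply: divr_gt0; last exact: Gamma_gt0.
apply: mulr_gt0; last exact: Gamma_gt0.
by rewrite mulr_gt0 ?powR_gt0 ?pi_gt0.
Qed.

Lemma rollnik_trinorm_potential V : rollnik_class alpha V ->
  ((rollnik_trinorm alpha V ^+ 2)%:E =
   (riesz_gamma d (2 * alpha - d%:R))%:E *
   L2norm mu (riesz_potential beta V) ^+ 2)%E.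
Proof.
move=> SV; rewrite /L2norm (sqr_Lnorm2 mu (fun x => normc (riesz_potential beta V x))).
under [X in (_ * X)%E]eq_integral do
  rewrite (riesz_potentialE _ SV) normcM normc_real
    ?mulr_ge0 ?invr_ge0 ?(ltW gamma_beta0) ?(ltW sqrtc0)//.
rewrite (integral_sqrZ _ _ (measurable_cpot SV)) (trinormE SV) (sqr_l2 (cpot_lty SV)).
rewrite muleA -EFinM; have := riesz_gammaM p0 hp0.
rewrite (_ : 4 * p = 2 * alpha - d%:R); last by rewrite /p; field.
rewrite (_ : 2 * p = beta); last by rewrite /p; field.
rewrite -/c; move: gamma_beta0.
move: (riesz_gamma d beta) (riesz_gamma d (2 * alpha - d%:R)) => g2 g4 g20 gE.
rewrite exprMn sqr_sqrtr ?(ltW c0)//.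
(* All constants cancel by [riesz_gammaM], that is, c g4 = g2^2. *)
rewrite (_ : g4 * (g2^-1 ^+ 2 * c) = 1) ?mul1e//.
by rewrite mulrCA (mulrC g4) gE exprVn mulVf// expf_neq0// gt_eqF.
Qed.

Lemma rollnik_norm_potential V : rollnik_class alpha V ->
  ((rollnik_norm alpha V ^+ 2)%:E =
   (riesz_gamma d (2 * alpha - d%:R))%:E *
   L2norm mu (riesz_potential beta (fun x => (normc (V x))%:C)) ^+ 2)%E.
Proof.
by move=> SV; rewrite (normE SV) (rollnik_trinorm_potential (class_absC SV)).
Qed.

End rollnik_theory.


Theorem theorem3p4 (R : realType) (d : nat) (alpha : R) :
  0 < alpha -> alpha < 2 -> alpha < d%:R -> d%:R < 2 * alpha ->
  is_norm_on_classes (lebesgue_Rd d)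
    (rollnik_class alpha) (rollnik_norm alpha) /\
  is_norm_on_classes (lebesgue_Rd d)
    (rollnik_class alpha) (rollnik_trinorm alpha) /\
  forall V : d.-tuple (measurableTypeR R) -> R[i], rollnik_class alpha V ->
    [/\ rollnik_form alpha V = (rollnik_trinorm alpha V ^+ 2)%:C,
        {ae lebesgue_Rd d, forall x, riesz_converges (alpha - d%:R / 2) V x},
        ((rollnik_trinorm alpha V ^+ 2)%:E =
         (riesz_gamma d (2 * alpha - d%:R))%:E *
         L2norm (lebesgue_Rd d)
           (riesz_potential (alpha - d%:R / 2) V) ^+ 2)%E &
        ((rollnik_norm alpha V ^+ 2)%:E =
         (riesz_gamma d (2 * alpha - d%:R))%:E *
         L2norm (lebesgue_Rd d)
           (riesz_potential (alpha - d%:R / 2) (fun x => (normc (V x))%:C)) ^+ 2)%E].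
Proof.
move=> alpha0 _ alphad dalpha; split; first exact: rollnik_norm_is_norm.
split=> [|V SV]; first exact: rollnik_trinorm_is_norm.
split.
- exact: rollnik_form_trinorm.
- exact: ae_riesz_converges.
- exact: rollnik_trinorm_potential.
- exact: rollnik_norm_potential.
Qed.
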